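(* Every digraph $D\in D(2,2)$ with $m$ edges has a directed cut of size at least $3m/10$.
   Context: All digraphs are finite, without loops and without parallel edges. For integers $k,\ell\ge 0$, $D(k,\ell)$ denotes the family of digraphs in which every vertex $v$ satisfies $d^-(v)\le k$ or $d^+(v)\le \ell$. A directed cut of a digraph $D$ is a set of edges of the form $\{xy\in E(D): x\in X, y\in Y\}$ for some partition $X,Y$ of $V(D)$; its size is its cardinality. *)

(* Defs.v *)
From HB Require Import structures.
From mathcomp Require Import all_boot all_order all_algebra.

Set Implicit Arguments.
Unset Strict Implicit.
Unset Printing Implicit Defensive.

(* Edges form a relation, so there are no parallel edges; opposite edges xy
   and yx are not parallel and may both be present. *)
Record digraph := Digraph {
  vertex :> finType;
  edge : rel vertex;
  edge_irrefl : irreflexive edge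
}.

Definition edges (D : digraph) : {set D * D} := [set e | edge e.1 e.2].

Definition indeg (D : digraph) (v : D) : nat := #|[set u : D | edge u v]|.

Definition outdeg (D : digraph) (v : D) : nat := #|[set w : D | edge v w]|.

Definition in_Dkl (k l : nat) (D : digraph) : Prop :=
  forall v : D, indeg v <= k \/ outdeg v <= l.

(* The parts X and Y may be empty: a one-vertex digraph has no partition into
   two nonempty parts, and its only directed cut is the empty one. *)
Definition directed_cut (D : digraph) (C : {set D * D}) : Prop :=
  exists X Y : {set D},
    [/\ X :|: Y = [set: D], [disjoint X & Y] &
        C = [set e in edges D | (e.1 \in X) && (e.2 \in Y)]].

(* Main.v *)
Require Import Defs.
From HB Require Import structures.
From mathcomp Require Import all_boot all_order all_algebra.
From mathcomp Require Import zify.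

Set Implicit Arguments.
Unset Strict Implicit.
Unset Printing Implicit Defensive.

(* Split the vertices into a side of indegree at most 2 and a side of outdegree at most 2, with as few
   backward edges (from the second side to the first) as possible, and complement the cut on the
   second side.  Edges inside a side, reversed in the second one, become arcs x -> y, won when z x = 1
   and z y = 0; forward edges are won when both ends are 1 and backward edges when both ends are 0.
   Every vertex now has at most two in-arcs and backward edges taken together.

   This bound survives the contraction of backward edges, so the contracted graph is 4-degenerate and
   has a 5-colouring.  When 3 random colours out of 5 get the value 1, arcs and forward edges are won
   with probability at least 3/10 and contracted backward edges with probability 4/10.  The only
   obstacles are arcs that become loops; giving up one backward edge per loop loses 3/10, which is
   harmless unless there are more than r/3 loops, where r is the number of backward edges.

   In that case the two sides are coloured independently, with 3 colours out of 5 set to 1 with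
   probability 7/10 and 2 out of 5 with probability 3/10.  Arcs and forward edges are still won with
   probability 3/10, backward edges with probability 22/100, and the missing 8/100 per backward edge
   are recovered by choosing the values on the path of each loop after everything else: this gains
   24/100 per loop, unless the path can be deleted and the theorem follows by induction. *)

(** * Five-colourings of contracted digraphs of small indegree *)

Lemma free_color (s : seq nat) : size s <= 4 -> exists2 i, i < 5 & i \notin s.
Proof.
move=> hs; case: (boolP (all (mem s) (iota 0 5))) => [/allP h|].
  by have := leq_trans (uniq_leq_size (iota_uniq 0 5) h) hs.
by case/allPn => i; rewrite mem_iota => /= hi hn; exists i.
Qed.

Section Coloring.
Variables (T : finType) (a : rel T).

Definition inarcs (v : T) := #|[set u | a u v]|.

(* [pi] is the contraction map: every vertex [r] of the contracted multigraph has indegree at most 2,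
   so every vertex set spans a vertex of degree at most 4. *)
Lemma degenerate_coloring (pi : T -> T) :
  (forall r, \sum_(v | pi v == r) inarcs v <= 2) ->
  exists2 col : T -> nat, forall x, col x < 5 &
    forall x y, a x y -> pi x != pi y -> col (pi x) != col (pi y).
Proof.
move=> hin.
suff: forall S : {set T}, exists2 col : T -> nat, forall x, col x < 5 &
    forall x y, pi x \in S -> pi y \in S -> a x y -> pi x != pi y ->
    col (pi x) != col (pi y).
  by move=> /(_ setT)[col h1 h2]; exists col => // x y; apply: h2; rewrite inE.
move=> S; have [n] := ubnP #|S|; elim: n S => // n IH S hS.
have [->|/set0Pn[r0 hr0]] := eqVneq S set0.
  by exists (fun=> 0) => // x y; rewrite inE.
pose adj r q := #|[set p : T * T | a p.1 p.2 & ((pi p.1 == r) && (pi p.2 == q)) || ((pi p.1 == q) && (pi p.2 == r))]|.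
pose out r q := \sum_(x | pi x == r) \sum_(y | pi y == q) a x y.
have adjE r q : adj r q <= out r q + out q r.
  rewrite /adj -sum1_card /out.
  rewrite (eq_bigl (fun p : T * T => a p.1 p.2 && (((pi p.1 == r) && (pi p.2 == q)) || ((pi p.1 == q) && (pi p.2 == r)))));
    last by move=> p; rewrite inE.
  rewrite !pair_big /=.
  rewrite big_mkcond [X in _ <= X + _]big_mkcond [X in _ <= _ + X]big_mkcond /= -big_split /=.
  apply: leq_sum => -[x y] _ /=.
  by case: (a x y); case: (pi x == r); case: (pi y == q); case: (pi x == q); case: (pi y == r).
have insum q : \sum_(r in S) out r q <= 2.
  apply: leq_trans (hin q); rewrite /out.
  under eq_bigr => r _ do rewrite exchange_big.
  rewrite exchange_big /=; apply: leq_sum => y _.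
  rewrite /inarcs -sum1_card [X in _ <= X]big_mkcond /=.
  rewrite (exchange_big_dep predT) //=.
  apply: leq_sum => x _; rewrite inE.
  rewrite (eq_bigr (fun _ => (a x y : nat))) // sum_nat_const.
  case: (a x y); rewrite ?muln0 // muln1.
  apply: (@leq_trans #|[set pi x]|); last by rewrite cards1.
  by apply: subset_leq_card; apply/subsetP => z; rewrite !inE => /andP[_ /eqP->].
(* The arcs inside [S] number at most [2 * #|S|], so the average degree in [S] is at most 4. *)
have [r hr hd] : exists2 r, r \in S & \sum_(q in S) (out r q + out q r) <= 4.
  apply/exists_inP; apply: contraT; rewrite negb_exists_in => /forall_inP hall.
  have h1 : \sum_(r in S) 5 <= \sum_(r in S) \sum_(q in S) (out r q + out q r).
    by apply: leq_sum => r /hall; rewrite -ltnNge.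
  have h2 : \sum_(r in S) \sum_(q in S) (out r q + out q r) <= \sum_(r in S) 4.
    under eq_bigr do rewrite big_split /=.
    rewrite big_split /= exchange_big /=.
    rewrite -big_split /=; apply: leq_sum => q _.
    by have := insum q; lia.
  move: (leq_trans h1 h2); rewrite !sum_nat_const.
  have : 0 < #|S| by apply/card_gt0P; exists r0.
  lia.
have [|col c5 hc] := IH (S :\ r); first by move: hS; rewrite (cardsD1 r) hr; lia.
pose nb := [set q in S :\ r | 0 < out r q + out q r].
have hnb : #|nb| <= 4.
  apply: leq_trans hd; rewrite -sum1_card [X in X <= _]big_mkcond [X in _ <= X]big_mkcond /=.
  apply: leq_sum => q _; rewrite !inE; case: (q \in S); last by rewrite andbF.
  by case: (q == r) => //=; case: ifP.
have [i i5 hi] : exists2 i, i < 5 & i \notin [seq col q | q <- enum nb].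
  by apply: free_color; rewrite size_map -cardE.
exists (fun x => if x == r then i else col x) => [x|x y]; first by case: ifP.
move=> xS yS axy nxy.
have outxy : 0 < out (pi x) (pi y).
  by rewrite /out (bigD1 x) //= (bigD1 y) //= axy.
case: (eqVneq (pi x) r) => [ex|nx]; case: (eqVneq (pi y) r) => [ey|ny].
- by rewrite ex ey eqxx in nxy.
- apply/eqP => h; case/negP: hi; apply/mapP; exists (pi y) => //.
  by rewrite mem_enum !inE ny yS -ex; lia.
- apply/eqP => h; case/negP: hi; apply/mapP; exists (pi x) => //.
  by rewrite mem_enum !inE nx xS -ey; lia.
- by apply: hc; rewrite ?inE ?nx ?ny.
Qed.

Definition ends (l : seq (T * T)) (v : T) := count (fun p => p.1 == v) l + count (fun p => p.2 == v) l.

(* Identifying the ends of a link costs both ends one unit, so the bound 2 survives the contraction. *)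
Lemma link_coloring (l : seq (T * T)) (E : rel T) (pi : T -> T) :
  (forall r, \sum_(v | pi v == r) (inarcs v + ends l v) <= 2) ->
  equivalence_rel E -> (forall x y, pi x = pi y -> E x y) -> {in l, forall p, E p.1 p.2} ->
  exists c : T -> nat, [/\ forall x, c x < 5, {in l, forall p, c p.1 = c p.2},
    forall x y, pi x = pi y -> c x = c y & forall x y, a x y -> ~~ E x y -> c x != c y].
Proof.
move=> + eE; have Er x : E x x by case: (eE x x x).
have Et x y z : E x y -> E x z = E y z by case: (eE x y z) => _ h /h.
have Es x y : E x y -> E y x by move=> h; rewrite -(Et _ _ x h).
elim: l pi => [|[x y] l IH] pi hin hpi hl.
  have [|col c5 hc] := @degenerate_coloring pi.
    move=> r; apply: leq_trans (hin r); apply: leq_sum => v _; exact: leq_addr.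
  exists (col \o pi); split=> [z|//|u v /= ->//|u v auv nE]; first exact: c5.
  by apply: hc => //; apply: contraNN nE => /eqP/hpi.
have hl' : {in l, forall p, E p.1 p.2} by move=> p hp; apply: hl; rewrite inE hp orbT.
have Exy : E x y by apply: (hl (x, y)); rewrite mem_head.
have e1 v : ends ((x, y) :: l) v = (x == v) + (y == v) + ends l v by rewrite /ends /=; lia.
(* The class of [x] is merged into that of [y]. [E] stays fixed during the induction: it contains
   all identifications to come, so an arc outside [E] never becomes a loop. *)
pose pi' z := if pi z == pi x then pi y else pi z.
have [r|u v|c [c5 cl cpi ca]] := IH pi' _ _ hl'.
- have [exy|nxy] := eqVneq (pi x) (pi y).
    apply: leq_trans (hin r); rewrite (eq_bigl (fun v => pi v == r)) => [|v]; last first.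
      by rewrite /pi'; case: (eqVneq (pi v) (pi x)) => [->|//]; rewrite exy.
    by apply: leq_sum => v _; rewrite e1; lia.
  have [->|nr] := eqVneq r (pi y).
    have -> : \sum_(v | pi' v == pi y) (inarcs v + ends l v) =
      \sum_(v | pi v == pi x) (inarcs v + ends l v) + \sum_(v | pi v == pi y) (inarcs v + ends l v).
      rewrite (bigID (fun v => pi v == pi x)) /=; congr (_ + _); apply: eq_bigl => v; rewrite /pi'.
        by case: (pi v == pi x); rewrite ?eqxx ?andbF.
      by case: (eqVneq (pi v) (pi x)) => [->|]; rewrite ?(negPf nxy) ?andbF ?andbT.
    have hx := hin (pi x); rewrite (bigD1 x) //= in hx.
    have hy := hin (pi y); rewrite (bigD1 y) //= in hy.
    set A := \sum_(v | _ == pi x) _; set B := \sum_(v | _) _.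
    have eA : A = inarcs x + ends l x + \sum_(v | (pi v == pi x) && (v != x)) (inarcs v + ends l v).
      by rewrite /A (bigD1 x).
    have eB : B = inarcs y + ends l y + \sum_(v | (pi v == pi y) && (v != y)) (inarcs v + ends l v).
      by rewrite /B (bigD1 y).
    rewrite !e1 !eqxx in hx hy.
    have hle P : \sum_(v | P v) (inarcs v + ends l v) <= \sum_(v | P v) (inarcs v + ends ((x, y) :: l) v).
      by apply: leq_sum => v _; rewrite e1; lia.
    have := hle (fun v => (pi v == pi x) && (v != x)); have := hle (fun v => (pi v == pi y) && (v != y)).
    lia.
  (* A class other than the merged one keeps its members or, if it was that of [x], becomes
     empty. *)
  apply: leq_trans (hin r); rewrite [X in _ <= X](bigID (fun v => pi v == pi x)) /=.
  rewrite (eq_bigl (fun v => (pi v == r) && (pi v != pi x))) => [|v]; last first.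
    rewrite /pi'; case: (eqVneq (pi v) (pi x)) => [->|_]; last by rewrite andbT.
    by rewrite eq_sym (negPf nr) andbF.
  apply: leq_trans (leq_addl _ _); apply: leq_sum => v _; rewrite e1; lia.
- rewrite /pi'; case: eqP => h1; case: eqP => h2 h.
  + by apply: hpi; rewrite h1.
  + by rewrite (Et _ _ _ (hpi u x h1)) (Et _ _ _ Exy); apply: hpi.
  + by apply: Es; rewrite (Et _ _ _ (hpi v x h2)) (Et _ _ _ Exy); apply: hpi.
  + exact: hpi.
exists c; split=> //.
- move=> p; rewrite inE => /predU1P[-> /=|]; last exact: cl.
  by apply: cpi; rewrite /pi' eqxx; case: eqP.
- by move=> u v h; apply: cpi; rewrite /pi' h.
Qed.

End Coloring.

(** * Paths of links closed by an arc, and families of them *)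

Definition sym (T : Type) (h : rel T) : rel T := fun x y => h x y || h y x.

Lemma symC (T : Type) (h : rel T) : symmetric (sym h).
Proof. by move=> x y; rewrite /sym orbC. Qed.

Definition nbr (T : finType) (h : rel T) (v : T) := [set w | sym h v w].

(** The last vertex is left out: unlike the others it may carry a link or an in-arc from outside the
    path. *)
Definition body (T : finType) (v : T) (p : seq T) : {set T} := [set x in belast v p].

Definition lrel (T : finType) (L : {set T * T}) : rel T := fun x y => (x, y) \in L.

Lemma closed_path (T : eqType) (e : rel T) (A : pred T) x p :
  (forall u w, e u w -> A u = A w) -> path e x p -> all (fun y => A y == A x) (x :: p).
Proof.
move=> h; elim: p x => [|y p IH] x; first by rewrite /= eqxx.
by move=> /andP[exy /IH]; rewrite /= (h _ _ exy) eqxx.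
Qed.

Section Blocks.
Variables (T : finType) (a r : rel T).
Hypothesis r_anti : forall x y, r x y -> ~~ r y x.
Hypothesis a_irr : irreflexive a.
Hypothesis deg2 : forall v, inarcs a v + #|nbr r v| <= 2.

(* A block is a path of links [v :: p] closed by an arc from its last vertex to [v]; the degree
   bound leaves no other arc into, and no other link at, the vertices of its body. *)
Definition block v p :=
  [&& path (sym r) v p, uniq (v :: p), p != [::] & a (last v p) v].

Section OneBlock.
Variables (v : T) (p : seq T).
Hypothesis bvp : block v p.
Let d := size p.
Let q i := nth v (v :: p) i.

Lemma block_size : 0 < d.
Proof. by case/and4P: bvp => _ _; rewrite /d; case: p. Qed.

Lemma block_link i : i < d -> sym r (q i) (q i.+1).
Proof. by case/and4P: bvp => /(pathP v) h _ _ _ hi; apply: h. Qed.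

Lemma block_inj i j : i <= d -> j <= d -> q i = q j -> i = j.
Proof. by case/and4P: bvp => _ u _ _ hi hj /eqP; rewrite nth_uniq //= => /eqP. Qed.

Lemma block_last : q d = last v p.
Proof. by rewrite /q /d (last_nth v). Qed.

Lemma bodyP x : reflect (exists2 i, i < d & x = q i) (x \in body v p).
Proof.
have e : belast v p = [seq q i | i <- iota 0 d].
  apply: (@eq_from_nth _ v) => [|i]; rewrite size_belast ?size_map ?size_iota //.
  move=> hi; rewrite (nth_map 0) ?size_iota // nth_iota // add0n /q.
  by rewrite lastI nth_rcons size_belast hi.
rewrite inE e; apply: (iffP mapP) => -[i hi ->]; exists i => //; move: hi; rewrite mem_iota //.
Qed.

Lemma last_notin_body : last v p \notin body v p.
Proof.
apply/bodyP => -[i hi]; rewrite -block_last => /(@block_inj d i (leqnn _) (ltnW hi)); lia.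
Qed.

Lemma head_in_body : v \in body v p.
Proof. by apply/bodyP; exists 0 => //; apply: block_size. Qed.

Lemma block_nbr0 : nbr r v = [set q 1] /\ forall x, a x v -> x = last v p.
Proof.
have h1 : q 1 \in nbr r v by rewrite inE; apply: (block_link block_size).
have c1 : 0 < #|nbr r v| by apply/card_gt0P; exists (q 1).
have hl : last v p \in [set u | a u v] by rewrite inE; case/and4P: bvp.
have c2 : 0 < inarcs a v by apply/card_gt0P; exists (last v p).
have := deg2 v => h.
split.
  by apply/esym/eqP; rewrite eqEcard sub1set h1 cards1; lia.
have : #|[set u | a u v]| <= 1 by rewrite /inarcs in h c2; lia.
move=> /card_le1_eqP hle x hx; apply: hle => //; by rewrite inE.
Qed.

Lemma block_nbrS i : 0 < i < d -> nbr r (q i) = [set q i.-1; q i.+1] /\ forall x, ~~ a x (q i).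
Proof.
case: i => // i /= hi; have hs : [set q i; q i.+2] \subset nbr r (q i.+1).
  apply/subsetP => x; rewrite !inE => /orP[]/eqP->; last exact: block_link.
  by rewrite symC; apply: block_link; lia.
have c2 : #|[set q i; q i.+2]| = 2.
  by rewrite cards2; case: eqP => // /block_inj -/(_ _ _); lia.
have := subset_leq_card hs; rewrite c2 => h2; have h := deg2 (q i.+1).
split; first by apply/esym/eqP; rewrite eqEcard hs c2; lia.
move=> x; apply/negP => ax.
have : 0 < inarcs a (q i.+1) by apply/card_gt0P; exists x; rewrite inE.
lia.
Qed.

Lemma arc_into_body x y : a x y -> y \in body v p -> y = v /\ x = last v p.
Proof.
move=> axy /bodyP[[|i] hi ey].
  by split=> //; apply: (proj2 block_nbr0); rewrite ey in axy.
by case: (@block_nbrS i.+1 hi) => _ /(_ x); rewrite -ey axy.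
Qed.

Lemma link_at_body x y : sym r x y -> x \in body v p ->
  exists2 i, i < d & (x = q i /\ y = q i.+1) \/ (x = q i.+1 /\ y = q i).
Proof.
move=> rxy /bodyP[[|i] hi ex].
  exists 0 => //; left; split=> //; have : y \in nbr r v by rewrite inE -[v]/(q 0) -ex.
  by rewrite (proj1 block_nbr0) inE => /eqP.
have : y \in nbr r (q i.+1) by rewrite inE -ex.
rewrite (proj1 (block_nbrS (i := i.+1) hi)) !inE => /orP[]/eqP ey.
  by exists i; [lia|right].
by exists i.+1 => //; left.
Qed.

End OneBlock.

Definition bodies (Bl : {set T}) (pp : T -> seq T) := \bigcup_(v in Bl) body v (pp v).

(** Only bodies are disjoint; two blocks may end at the same vertex. *)
Record block_family (Bl : {set T}) (pp : T -> seq T) := BlockFamily {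
  fam_block : forall v, v \in Bl -> block v (pp v);
  fam_disj : forall v w, v \in Bl -> w \in Bl -> v != w ->
    [disjoint body v (pp v) & body w (pp w)];
  fam_last : forall v w, v \in Bl -> w \in Bl -> last v (pp v) \notin body w (pp w)
}.

Definition linkset := [set p : T * T | r p.1 p.2].

(** An arc joining two vertices of one component of links closes a block. Deleting the last link of
    its path cuts the body off from all other vertices, hence from the blocks found afterwards. [L]
    collects the surviving links. *)
Lemma block_family_exists : exists Bl pp (L : {set T * T}),
  [/\ block_family Bl pp, L \subset linkset, #|linkset :\: L| <= #|Bl| &
      forall x y, a x y -> ~~ connect (sym (lrel L)) x y].
Proof.
(* Stated for subsets of the links so that links can be deleted; the paths must then use links of
   [L0] only. *)
suff: forall L0 : {set T * T}, L0 \subset linkset -> exists Bl pp (L : {set T * T}),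
  [/\ block_family Bl pp, L \subset L0, #|L0 :\: L| <= #|Bl|,
      forall v, v \in Bl -> path (sym (lrel L0)) v (pp v) &
      forall x y, a x y -> ~~ connect (sym (lrel L)) x y].
  by move=> /(_ _ (subxx _))[Bl][pp][L][h1 h2 h3 _ h5]; exists Bl, pp, L.
move=> L0; have [n] := ubnP #|L0|; elim: n L0 => // n IH L0 hn hL0.
have [hall|] := boolP [forall x, forall y, a x y ==> ~~ connect (sym (lrel L0)) x y].
  exists set0, (fun=> [::]), L0; split=> //; first by split=> [v|v w|v w]; rewrite inE.
  - by rewrite setDv cards0.
  - by move=> x y axy; move/forallP/(_ x)/forallP/(_ y)/implyP: hall; apply.
rewrite negb_forall => /existsP[u]; rewrite negb_forall => /existsP[v].
rewrite negb_imply negbK => /andP[auv].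
rewrite (sym_connect_sym (symC _)) => /connectP[p0 hp0 ep0].
case/shortenP: hp0 ep0 => p hp up _ eu; rewrite {u}eu in auv.
have subr (L : {set T * T}) : L \subset linkset -> subrel (sym (lrel L)) (sym r).
  by move=> h x y /orP[]/(subsetP h); rewrite inE /sym /= => ->; rewrite ?orbT.
have pn0 : p != [::] by apply/eqP => e; rewrite e /= a_irr in auv.
have bvp : block v p by rewrite /block (sub_path (subr _ hL0) hp) up pn0 auv.
set B := body v p; set d := size p; pose q i := nth v (v :: p) i.
have d0 : 0 < d := block_size bvp.
have qd : q d = last v p by apply: block_last.
pose x := q d.-1; pose y := q d.
have lxy : sym (lrel L0) x y.
  by rewrite /x /y -{2}(prednK d0); apply: (pathP v hp); rewrite ltn_predL.
pose e0 := if (x, y) \in L0 then (x, y) else (y, x).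
have e0L : e0 \in L0 by rewrite /e0; case: ifP => // h; move: lxy; rewrite /sym /lrel h.
pose L1 := L0 :\ e0.
have hL1 : L1 \subset linkset by apply: subset_trans hL0; apply: subsetDl.
have lxyN : ~~ sym (lrel L1) x y.
  have anti z w : (z, w) \in L0 -> (w, z) \notin L0.
    move=> /(subsetP hL0); rewrite inE /= => /r_anti h; apply: contra h.
    by move/(subsetP hL0); rewrite inE.
  rewrite /sym /lrel !inE negb_or /e0; case: ifP => h.
    by rewrite eqxx /= (negPf (anti _ _ h)) andbF.
  by rewrite eqxx andbF.
(* The deleted link was the only one between the body and the rest. *)
have clB z w : sym (lrel L1) z w -> (z \in B) = (w \in B).
  have imp z' w' : sym (lrel L1) z' w' -> z' \in B -> w' \in B.
    move=> l /(link_at_body bvp (subr _ hL1 _ _ l))[i hi [[ez ew]|[ez ew]]].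
      have [hi'|hi'] := ltnP i.+1 d; first by apply/bodyP; exists i.+1.
      have ei : i = d.-1 by clear -hi hi' d0; rewrite -/d in hi; lia.
      case/negP: lxyN; move: l; rewrite ez ew ei (prednK d0) //.
    by apply/bodyP; exists i.
  by move=> l; apply/idP/idP; apply: imp => //; rewrite symC.
have [|Bl [pp [L [fam hL hc hpth hno]]]] := IH L1 _ hL1.
  by move: hn; rewrite ltnS; apply: leq_trans; rewrite [X in _ <= X](cardsD1 e0) e0L.
have lastB : last v p \notin B := last_notin_body bvp.
(* A later path starting in [B] would stay in [B], but its closing arc would have to come from
   [last v p], which is outside. *)
have outB w : w \in Bl -> all (fun z => z \notin B) (w :: pp w).
  move=> hw; have := closed_path (A := mem B) clB (hpth w hw) => hall.
  have bw := fam_block fam hw.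
  have hwB : w \notin B.
    apply/negP => hwB; case/and4P: bw => _ _ _ alw.
    have [_ el] := arc_into_body bvp alw hwB; case/negP: lastB; rewrite -el.
    by have /allP/(_ _ (mem_last _ _))/eqP /= -> := hall.
  by apply/allP => z /(allP hall)/eqP /= ->.
have subB w z : z \in body w (pp w) -> z \in w :: pp w.
  by rewrite inE lastI mem_rcons inE => ->; rewrite orbT.
have disB w : w \in Bl -> [disjoint B & body w (pp w)].
  move=> hw; rewrite disjoint_sym; apply/pred0P => z /=; apply/negP => /andP[/subB h].
  by have /allP/(_ _ h)/negP := outB w hw.
have vBl : v \notin Bl.
  by apply/negP => /outB /=; rewrite (head_in_body bvp).
(* Inside a later body, all links of [last v p] would lie on the path of that block, hence in [L1],
   unlike the deleted link to [x]. *)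
have lastN w : w \in Bl -> last v p \notin body w (pp w).
  move=> hw; have bw := fam_block fam hw; apply/negP => hb.
  have hx : x \in nbr r (last v p).
    by rewrite inE symC -qd; apply: (subr _ hL0).
  have hxN z : sym (lrel L1) (last v p) z -> z != x.
    by apply: contraTneq => ->; rewrite -qd symC.
  have /bodyP[[|i] hi ei] := hb.
    have [e1 _] := block_nbr0 bw; rewrite ei /= e1 inE in hx.
    suff: nth w (w :: pp w) 1 != x by rewrite eq_sym hx.
    apply: hxN; have /(pathP w)/(_ 0 hi) := hpth w hw; rewrite ei //.
  have [e1 _] := block_nbrS bw (i := i.+1) hi; rewrite ei e1 !inE /= in hx.
  case/orP: hx => hx.
    suff: nth w (w :: pp w) i != x by rewrite eq_sym hx.
    apply: hxN; have /(pathP w)/(_ i (ltnW hi)) := hpth w hw; rewrite ei symC //.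
  suff: nth w (w :: pp w) i.+2 != x by rewrite eq_sym hx.
  apply: hxN; have /(pathP w)/(_ i.+1 hi) := hpth w hw; rewrite ei //.
pose pp' z := if z == v then p else pp z.
have ppv : pp' v = p by rewrite /pp' eqxx.
have ppw w : w \in Bl -> pp' w = pp w.
  by move=> hw; rewrite /pp'; case: eqP => // e; rewrite e (negPf vBl) in hw.
exists (v |: Bl), pp', L; split=> //.
- split.
  + by move=> w /setU1P[->|hw]; rewrite ?ppv // ppw //; apply: (fam_block fam).
  + move=> w w' /setU1P[->|hw] /setU1P[->|hw']; rewrite ?eqxx // ?ppv ?ppw // => nw.
    * exact: disB.
    * by rewrite disjoint_sym; apply: disB.
    * exact: (fam_disj fam).
  + move=> w w' /setU1P[->|hw] /setU1P[->|hw']; rewrite ?ppv ?ppw //; first exact: lastN.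
      by have /allP/(_ _ (mem_last _ _)) := outB w hw.
    exact: (fam_last fam).
- exact: subset_trans hL (subsetDl _ _).
- have : L0 :\: L \subset e0 |: (L1 :\: L).
    by apply/subsetP => z; rewrite !inE; case: (z == e0) => //= /andP[-> ->].
  move/subset_leq_card => h; rewrite (cardsU1 v Bl) vBl add1n.
  apply: leq_trans h _; rewrite cardsU1 -[X in _ <= X]add1n; exact: leq_add (leq_b1 _) hc.
- move=> w /setU1P[->|hw]; rewrite ?ppv // ppw //.
  apply: sub_path (hpth w hw) => z t /orP[]; rewrite /lrel !inE /sym /lrel => /andP[_ ->] //.
  by rewrite orbT.
Qed.

End Blocks.

(** * Gains, and what the bodies are worth at value 0 *)

Section Gain.
Variables (T : finType) (a r f : rel T).

Definition rgain (z : pred T) (p : T * T) : nat := [&& r p.1 p.2, ~~ z p.1 & ~~ z p.2].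
Definition again (z : pred T) (p : T * T) : nat := [&& a p.1 p.2, z p.1 & ~~ z p.2].
Definition fgain (z : pred T) (p : T * T) : nat := [&& f p.1 p.2, z p.1 & z p.2].
Definition gain z p := again z p + rgain z p + fgain z p.
Definition touch (W : {set T}) (p : T * T) := (p.1 \in W) || (p.2 \in W).

Lemma touch_sum (W : {set T}) (h : T * T -> nat) :
  \sum_(p | touch W p) h p = \sum_(x in W) \sum_(y in W) h (x, y) +
     \sum_(x in W) \sum_(y in ~: W) (h (x, y) + h (y, x)).
Proof.
under [X in _ = _ + X]eq_bigr do rewrite big_split.
rewrite big_split /= addnA -big_split /=.
under [X in _ = X + _]eq_bigr => x _.
  have -> : \sum_(y in W) h (x, y) + \sum_(y in ~: W) h (x, y) = \sum_y h (x, y).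
    rewrite [RHS](bigID (mem W)) /=; congr (_ + _); apply: eq_bigl => y; by rewrite inE.
  over.
rewrite [X in _ = _ + X]exchange_big /= !pair_big /= (bigID (fun p => p.1 \in W)) /=.
congr (_ + _); apply: eq_big => [[x y]|[x y]] //=; rewrite /touch /= ?inE.
  by case: (x \in W); rewrite ?andbF.
by case: (x \in W); rewrite ?andbF ?andbT.
Qed.

Hypothesis r_anti : forall x y, r x y -> ~~ r y x.
Hypothesis deg2 : forall v, inarcs a v + #|nbr r v| <= 2.

Section Block.
Variables (v : T) (p : seq T).
Hypothesis bvp : block a r v p.
Let d := size p.
Let q i := nth v (v :: p) i.
Let orient i := if r (q i) (q i.+1) then (q i, q i.+1) else (q i.+1, q i).

(** By the degree bound every link touching the body lies on the path; [orient] recovers its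
    direction in [r]. *)
Lemma block_rcount : \sum_(x | touch (body v p) x) r x.1 x.2 <= d.
Proof.
rewrite -[d]card_ord; have hc := leq_imset_card (fun i : 'I_d => orient i) (mem [set: 'I_d]).
apply: leq_trans (leq_trans hc _); last by rewrite cardsT.
rewrite -sum1_card big_mkcond [X in _ <= X]big_mkcond /=; apply: leq_sum => -[x y] _ /=.
case: ifP => // hxy; case rxy: (r x y) => //=.
suff -> : (x, y) \in [set orient i | i : 'I_d in [set: 'I_d]] by [].
have [i hi e] : exists2 i, i < d & (x = q i /\ y = q i.+1) \/ (x = q i.+1 /\ y = q i).
  case/orP: hxy => /= h.
    by apply: (link_at_body deg2 bvp _ h); rewrite /sym rxy.
  have syx : sym r y x by rewrite /sym rxy orbT.
  have [i hi e] := link_at_body deg2 bvp syx h.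
  by exists i => //; case: e => -[-> ->]; [right|left].
apply/imsetP; exists (Ordinal hi) => //; rewrite /orient /=.
by case: e => -[<- <-]; rewrite ?rxy // (negPf (r_anti rxy)).
Qed.

(** All links inside the body are won. The last vertex is not controlled, but its value 0 wins the
    last link and its value 1 wins the closing arc. *)
Lemma block_zero_gain (z : pred T) : (forall x, x \in body v p -> ~~ z x) ->
  d <= \sum_(x | touch (body v p) x) rgain z x + \sum_(x | x.2 \in body v p) again z x.
Proof.
move=> hz; have d0 : 0 < d := block_size bvp.
have qd : q d = last v p by apply: block_last.
have hu : (z (last v p) : nat) <= \sum_(x | x.2 \in body v p) again z x.
  rewrite (bigD1 (last v p, v)) /=; last exact: head_in_body bvp.
  by rewrite /again /= (hz _ (head_in_body bvp)); case/and4P: bvp => _ _ _ ->; rewrite andbT leq_addr.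
suff : \sum_(i < d) ~~ z (q i.+1) <= \sum_(x | touch (body v p) x) rgain z x.
  have -> : \sum_(i < d) ~~ z (q i.+1) = d.-1 + ~~ z (last v p).
    rewrite -(big_mkord xpredT (fun i => ~~ z (q i.+1) : nat)) -{1}(prednK d0) big_nat_recr //=.
    rewrite (prednK d0) -qd; congr (_ + _).
    rewrite big_nat (eq_bigr (fun=> 1)) => [|i hi]; first by rewrite -big_nat sum_nat_const_nat; lia.
    by rewrite hz //; apply/bodyP; exists i.+1 => //; lia.
  by move=> h; case: (z _) h hu => /=; lia.
have -> : \sum_(i < d) ~~ z (q i.+1) = #|[set i : 'I_d | ~~ z (q i.+1)]|.
  rewrite -sum1_card [RHS]big_mkcond /=; apply: eq_bigr => i _; rewrite inE; by case: ifP.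
have inj : {in [set i : 'I_d | ~~ z (q i.+1)] &, injective (fun i : 'I_d => orient i)}.
  move=> i j _ _; have hi := ltn_ord i; have hj := ltn_ord j; rewrite /orient => e; apply: val_inj => /=.
  have inj := block_inj bvp.
  case: ifP e => _; case: ifP => _ [e1 e2].
  - by apply: inj e1; lia.
  - by have := inj i j.+1 _ _ e1; have := inj i.+1 j _ _ e2; lia.
  - by have := inj i.+1 j _ _ e1; have := inj i j.+1 _ _ e2; lia.
  - by apply: inj e2; lia.
rewrite -(card_in_imset inj) -sum1_card big_mkcond [X in _ <= X]big_mkcond /=.
apply: leq_sum => x _; case: ifP => // /imsetP[i]; rewrite inE => hi ->.
have hb : q i \in body v p by apply/bodyP; exists i.
have tp : touch (body v p) (orient i).
  by rewrite /orient /touch; case: (r _ _); rewrite /= hb ?orbT.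
have rp : rgain z (orient i) = 1.
  have := block_link bvp (ltn_ord i); rewrite -/(q i) -/(q i.+1) /sym /orient /rgain.
  by case: ifP => /= h; [rewrite h|move=> ->]; rewrite (hz _ hb) hi.
by rewrite tp rp.
Qed.

End Block.

Section Family.
Variables (X : {set T}) (pp : T -> seq T).
Hypothesis fam : block_family a r X pp.
Let W := bodies X pp.

Lemma in_bodies x : reflect (exists2 v, v \in X & x \in body v (pp v)) (x \in W).
Proof. exact: bigcupP. Qed.

Lemma last_notin v : v \in X -> last v (pp v) \notin W.
Proof. by move=> hv; apply/in_bodies => -[w hw]; apply/negP; apply: (fam_last fam). Qed.

Lemma body_unique v w x : v \in X -> w \in X -> x \in body v (pp v) -> x \in body w (pp w) -> v = w.
Proof.
move=> hv hw xv xw; apply/eqP; apply: contraT => nvw.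
by have /pred0P/(_ x) := fam_disj fam hv hw nvw; rewrite /= xv xw.
Qed.

(** A link leaving a body ends at the last vertex of its path, which lies in no body. *)
Lemma link_touch_unique v w x : v \in X -> w \in X -> r x.1 x.2 ->
  touch (body v (pp v)) x -> touch (body w (pp w)) x -> v = w.
Proof.
move=> hv hw rx tv tw.
suff key y t : sym r y t -> y \in body v (pp v) -> t \in body w (pp w) -> v = w.
  have sx : sym r x.1 x.2 by rewrite /sym rx.
  case/orP: tv => xv; case/orP: tw => xw; try exact: body_unique xv xw.
    exact: key sx xv xw.
  by apply: key xv xw; rewrite symC.
move=> sx xv xw; have [i hi e] := link_at_body deg2 (fam_block fam hv) sx xv.
have [tb|tn] := boolP (t \in body v (pp v)); first exact: body_unique tb xw.
have et : t = last v (pp v).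
  case: e => -[_ e]; last by rewrite e in tn; case/bodyP: tn; exists i.
  rewrite e -(block_last v (pp v)); congr nth.
  have [h|] := ltnP i.+1 (size (pp v)); last by lia.
  by case/bodyP: tn; exists i.+1.
by have := fam_last fam hv hw; rewrite -et xw.
Qed.

Lemma arc_into_bodies x y : a x y -> y \in W -> [/\ y \in X, x = last y (pp y) & x \notin W].
Proof.
move=> axy /in_bodies[v hv yv]; have [-> ->] := arc_into_body deg2 (fam_block fam hv) axy yv.
by split=> //; apply: last_notin.
Qed.

Lemma family_rcount : \sum_(x | touch W x) r x.1 x.2 <= \sum_(v in X) size (pp v).
Proof.
apply: (@leq_trans (\sum_(v in X) \sum_(x | touch (body v (pp v)) x) r x.1 x.2)); last first.
  by apply: leq_sum => v hv; apply: block_rcount (fam_block fam hv).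
rewrite (exchange_big_dep predT) //= big_mkcond; apply: leq_sum => x _.
case: ifP => // tx.
have [v hv tv] : exists2 v, v \in X & touch (body v (pp v)) x.
  by case/orP: tx => /in_bodies[v hv h]; exists v => //; rewrite /touch h ?orbT.
by rewrite (bigD1 v) ?hv //= leq_addr.
Qed.

Lemma family_incount : \sum_(x in W) \sum_(y in ~: W) a y x <= #|X|.
Proof.
rewrite -sum1_card (bigID (mem X)) /= [X in _ + X]big1 ?addn0 => [|x /andP[xW xX]]; last first.
  rewrite big1 // => y _; case ayx: (a y x) => //.
  by have [] := arc_into_bodies ayx xW; rewrite (negPf xX).
rewrite big_mkcond [X in _ <= X]big_mkcond; apply: leq_sum => x _.
case: ifP => // /andP[xW ->]; rewrite -(cards1 (last x (pp x))) -sum1_card.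
rewrite big_mkcond [X in _ <= X]big_mkcond; apply: leq_sum => y _; rewrite inE.
case ayx: (a y x); last by case: ifP; case: ifP.
by have [_ -> _] := arc_into_bodies ayx xW; rewrite inE eqxx; case: ifP.
Qed.

Lemma family_zero_gain (z : pred T) : (forall x, x \in W -> ~~ z x) ->
  \sum_(v in X) size (pp v) <= \sum_(x | touch W x) gain z x.
Proof.
move=> hz.
apply: (@leq_trans (\sum_(v in X) (\sum_(x | touch (body v (pp v)) x) rgain z x +
     \sum_(x | x.2 \in body v (pp v)) again z x))).
  apply: leq_sum => v hv; apply: (block_zero_gain (fam_block fam hv)) => x xv.
  by apply: hz; apply/in_bodies; exists v.
rewrite big_split /= (exchange_big_dep predT) //= [X in _ + X <= _](exchange_big_dep predT) //=.
rewrite -big_split big_mkcond [X in _ <= X]big_mkcond /=.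
apply: leq_sum => x _.
(* Each link and each arc is charged to at most one block, so the double sums collapse. *)
have one (P : pred T) n : (forall v w, P v -> P w -> v = w) -> \sum_(v | P v) n <= n.
  move=> hP; rewrite sum_nat_const; case: n => [|n]; first by rewrite muln0.
  have : #|P| <= 1 by apply/card_le1_eqP => v w hv hw; apply: hP.
  by move: #|P| => [|[|k]] //; rewrite ?mul1n ?mul0n.
have le1 : \sum_(v in X | touch (body v (pp v)) x) rgain z x <= rgain z x.
  case rx: (r x.1 x.2); last by rewrite /rgain rx big1.
  by apply: one => v w /andP[hv tv] /andP[hw tw]; apply: (link_touch_unique hv hw rx).
have le2 : \sum_(v in X | x.2 \in body v (pp v)) again z x <= again z x.
  by apply: one => v w /andP[hv tv] /andP[hw tw]; apply: (body_unique hv hw tv).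
case: ifP => tx; first by rewrite /gain; lia.
have hW v y : v \in X -> y \in body v (pp v) -> y \in W by move=> hv yv; apply/in_bodies; exists v.
move/negbT: tx; rewrite negb_or => /andP[n1 n2].
rewrite big_pred0 ?big_pred0 // => v; apply/negP => /andP[hv].
  by move/(hW _ _ hv); apply/negP.
by case/orP => /(hW _ _ hv); apply/negP.
Qed.

End Family.
End Gain.

(** * Random draws of two colours out of five *)

Definition pairs : seq (nat * nat) :=
  [:: (0, 1); (0, 2); (0, 3); (0, 4); (1, 2); (1, 3); (1, 4); (2, 3); (2, 4); (3, 4)].

(* Colour [i] gets the value 1 when it avoids the drawn pair, or, if [q], when it belongs to it. *)
Definition zb (q : bool) (p : nat * nat) (i : nat) : bool := ((i == p.1) || (i == p.2)) == q.

Lemma sum_pairs_const k : \sum_(p <- pairs) k = 10 * k.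
Proof. by rewrite big_const_seq count_predT iter_addn_0 mulnC. Qed.

Lemma sum_zb1 q i : i < 5 -> \sum_(p <- pairs) zb q p i = if q then 4 else 6.
Proof. by case: q; move: i => [|[|[|[|[|i]]]]] //; rewrite unlock. Qed.

Lemma sum_zb0 q i : i < 5 -> \sum_(p <- pairs) ~~ zb q p i = if q then 6 else 4.
Proof. by case: q; move: i => [|[|[|[|[|i]]]]] //; rewrite unlock. Qed.

(** For either [q], the pair must contain one of the two colours and avoid the other, which leaves 3
    choices for its second element. *)
Lemma sum_zb10 q i j : i < 5 -> j < 5 -> i != j -> \sum_(p <- pairs) (zb q p i && ~~ zb q p j) = 3.
Proof.
by case: q; move: i => [|[|[|[|[|i]]]]] //; move: j => [|[|[|[|[|j]]]]] //; rewrite unlock.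
Qed.

Lemma sum_zb11 i j : i < 5 -> j < 5 -> 3 <= \sum_(p <- pairs) (zb false p i && zb false p j).
Proof.
by move: i => [|[|[|[|[|i]]]]] //; move: j => [|[|[|[|[|j]]]]] //; rewrite unlock.
Qed.

(** The worst case is that of distinct colours, where only the pair formed by [i] and [j] counts. *)
Lemma sum_zb00 i j : i < 5 -> j < 5 -> 1 <= \sum_(p <- pairs) (~~ zb false p i && ~~ zb false p j).
Proof.
by move: i => [|[|[|[|[|i]]]]] //; move: j => [|[|[|[|[|j]]]]] //; rewrite unlock.
Qed.

Lemma pairs_pigeonhole (g : nat * nat -> nat) K :
  K <= \sum_(p <- pairs) g p -> exists p, K <= 10 * g p.
Proof.
move=> h; have [/hasP[p _ hp]|] := boolP (has (fun p => K <= 10 * g p) pairs); first by exists p.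
rewrite -all_predC => /allP hall.
have : \sum_(p <- pairs) 10 * g p + \sum_(p <- pairs) 1 <= \sum_(p <- pairs) K.
  rewrite -big_split /= big_seq [X in _ <= X]big_seq; apply: leq_sum => p /hall /=; lia.
rewrite -big_distrr /= !sum_pairs_const; lia.
Qed.

(* Expectation scaled by 1000: the sides draw their pairs independently, [q] is false with odds 7 : 3,
   the odds for which 0.7 * (3/5)^2 + 0.3 * (2/5)^2 = 3/10. *)
Definition Ex (g : bool -> nat * nat -> nat * nat -> nat) : nat :=
  \sum_(p <- pairs) \sum_(p' <- pairs) (7 * g false p p' + 3 * g true p p').

Lemma Ex_pigeonhole g K : 1000 * K <= Ex g -> exists q p p', K <= g q p p'.
Proof.
move=> h; have [p] := pairs_pigeonhole h; rewrite big_distrr => /= hp.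
have [p' hp'] := pairs_pigeonhole hp.
have [h1|h1] := leqP K (g false p p'); first by exists false, p, p'.
by exists true, p, p'; lia.
Qed.

Lemma ExD g h : Ex (fun q p p' => g q p p' + h q p p') = Ex g + Ex h.
Proof.
rewrite /Ex -big_split; apply: eq_bigr => p _; rewrite -big_split; apply: eq_bigr => p' _ /=; lia.
Qed.

Lemma Ex_le g h : (forall q p p', g q p p' <= h q p p') -> Ex g <= Ex h.
Proof. by move=> le; apply: leq_sum => p _; apply: leq_sum => p' _; rewrite leq_add ?leq_mul. Qed.

Lemma Ex_sum (I : finType) (P : pred I) (g : I -> bool -> nat * nat -> nat * nat -> nat) :
  Ex (fun q p p' => \sum_(i | P i) g i q p p') = \sum_(i | P i) Ex (g i).
Proof.
rewrite /Ex [RHS]exchange_big; apply: eq_bigr => p _; rewrite [RHS]exchange_big; apply: eq_bigr => p' _.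
by rewrite big_split !big_distrr.
Qed.

Lemma ExM k g : Ex (fun q p p' => k * g q p p') = k * Ex g.
Proof.
rewrite /Ex big_distrr; apply: eq_bigr => p _; rewrite big_distrr; apply: eq_bigr => p' _ /=; lia.
Qed.

Lemma Ex_eq g h : (forall q p p', g q p p' = h q p p') -> Ex g = Ex h.
Proof. by move=> e; apply: eq_bigr => p _; apply: eq_bigr => p' _; rewrite !e. Qed.

Lemma Ex_const k : Ex (fun _ _ _ => k) = 1000 * k.
Proof. by rewrite /Ex !sum_pairs_const; lia. Qed.

Lemma Ex_q (g : bool -> nat) : Ex (fun q _ _ => g q) = 700 * g false + 300 * g true.
Proof. by rewrite /Ex !sum_pairs_const; lia. Qed.

(** Puts the pair of a chosen side first, so that computations about one vertex need not distinguish
    its side. *)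
Definition swap (T : Type) (b : bool) (x y : T) := if b then x else y.

Lemma swapK (T : Type) b (x y : T) : swap b (swap b x y) (swap b y x) = x.
Proof. by case: b. Qed.

Lemma Ex_swap b g : Ex (fun q p p' => g q (swap b p p') (swap b p' p)) = Ex g.
Proof. by case: b => //; rewrite /Ex exchange_big. Qed.

(** The factors are the weights 7 and 3 times the ten draws of the other side. *)
Lemma Ex_1 (g : bool -> nat * nat -> nat) : Ex (fun q p _ => g q p) =
  70 * (\sum_(p <- pairs) g false p) + 30 * (\sum_(p <- pairs) g true p).
Proof.
by rewrite /Ex !big_distrr -big_split; apply: eq_bigr => p _ /=; rewrite sum_pairs_const; lia.
Qed.

Lemma Ex_prod (g h : bool -> nat * nat -> bool) : Ex (fun q p p' => g q p && h q p') =
  7 * ((\sum_(p <- pairs) g false p) * \sum_(p <- pairs) h false p) +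
  3 * ((\sum_(p <- pairs) g true p) * \sum_(p <- pairs) h true p).
Proof.
rewrite /Ex !big_distrl !big_distrr -big_split; apply: eq_bigr => p _ /=.
by rewrite !big_distrr -big_split; apply: eq_bigr => p' _ /=; rewrite !mulnb.
Qed.

Section Base.
Variables (T : finType) (s : pred T) (c : T -> nat).
Hypothesis c5 : forall x, c x < 5.

Definition zside q p p' : pred T := fun x => zb q (swap (s x) p p') (c x).

Lemma zside_swap b q p p' x : zside q (swap b p p') (swap b p' p) x = zb q (swap (s x == b) p p') (c x).
Proof. by rewrite /zside; case: b; case: (s x). Qed.

Lemma Ex_zside (g : bool -> bool -> nat) x : Ex (fun q p p' => g q (zside q p p' x)) =
  70 * (6 * g false true + 4 * g false false) + 30 * (4 * g true true + 6 * g true false).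
Proof.
rewrite -(Ex_swap (s x)) (@Ex_eq _ (fun q p p' => g q (zb q p (c x)))); last first.
  by move=> q p p'; rewrite zside_swap eqxx.
rewrite Ex_1; congr (_ * _ + _ * _).
  have e p : g false (zb false p (c x)) = zb false p (c x) * g false true + ~~ zb false p (c x) * g false false.
    by case: (zb _ _ _); lia.
  by rewrite (eq_bigr _ (fun p _ => e p)) big_split -!big_distrl /= sum_zb1 // sum_zb0.
have e p : g true (zb true p (c x)) = zb true p (c x) * g true true + ~~ zb true p (c x) * g true false.
  by case: (zb _ _ _); lia.
by rewrite (eq_bigr _ (fun p _ => e p)) big_split -!big_distrl /= sum_zb1 // sum_zb0.
Qed.

Lemma Ex_same x y : s x = s y -> c x != c y -> Ex (fun q p p' => zside q p p' x && ~~ zside q p p' y) = 300.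
Proof.
move=> exy nc; rewrite -(Ex_swap (s x)) (@Ex_eq _ (fun q p p' => zb q p (c x) && ~~ zb q p (c y))).
  by rewrite Ex_1 !sum_zb10.
by move=> q p p'; rewrite !zside_swap -exy eqxx.
Qed.

Lemma Ex_cross11 x y : s x != s y -> Ex (fun q p p' => zside q p p' x && zside q p p' y) = 300.
Proof.
move=> nxy; rewrite -(Ex_swap (s x)) (@Ex_eq _ (fun q p p' => zb q p (c x) && zb q p' (c y))).
  by rewrite (Ex_prod (fun q p => zb q p (c x)) (fun q p => zb q p (c y))) !sum_zb1.
by move=> q p p'; rewrite !zside_swap eqxx eq_sym (negPf nxy).
Qed.

(** By independence this is [7 * 4 * 4 + 3 * 6 * 6], against [7 * 6 * 6 + 3 * 4 * 4 = 300] for two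
    ones; the blocks have to repay the missing 80. *)
Lemma Ex_cross00 x y : s x != s y -> Ex (fun q p p' => ~~ zside q p p' x && ~~ zside q p p' y) = 220.
Proof.
move=> nxy; rewrite -(Ex_swap (s x)) (@Ex_eq _ (fun q p p' => ~~ zb q p (c x) && ~~ zb q p' (c y))).
  by rewrite (Ex_prod (fun q p => ~~ zb q p (c x)) (fun q p => ~~ zb q p (c y))) !sum_zb0.
by move=> q p p'; rewrite !zside_swap eqxx eq_sym (negPf nxy).
Qed.

End Base.

(** * Few loops: surviving links get equal colours at both ends *)

Section Tied.
Variables (T : finType) (a r f : rel T).
Hypothesis r_anti : forall x y, r x y -> ~~ r y x.
Hypothesis deg2 : forall v, inarcs a v + #|nbr r v| <= 2.

Lemma ends_nbr (L : {set T * T}) v : L \subset linkset r -> ends (enum L) v <= #|nbr r v|.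
Proof.
move=> hL; have rL x y : (x, y) \in L -> r x y by move/(subsetP hL); rewrite inE.
rewrite /ends -!sum1_count !big_enum_cond /=.
have -> : \sum_(p in L | p.1 == v) 1 = \sum_w ((v, w) \in L).
  transitivity (\sum_x \sum_y if ((x, y) \in L) && (x == v) then 1 else 0).
    by rewrite pair_bigA big_mkcond; apply: eq_bigr => -[].
  rewrite (bigD1 v) //= [X in _ + X]big1 ?addn0.
    by apply: eq_bigr => w _; rewrite eqxx andbT; case: (_ \in _).
  by move=> x nx; rewrite big1 // => y _; rewrite (negPf nx) andbF.
have -> : \sum_(p in L | p.2 == v) 1 = \sum_w ((w, v) \in L).
  transitivity (\sum_x \sum_y if ((x, y) \in L) && (y == v) then 1 else 0).
    by rewrite pair_bigA big_mkcond; apply: eq_bigr => -[].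
  apply: eq_bigr => w _; rewrite (bigD1 v) //= eqxx andbT big1 ?addn0; first by case: (_ \in _).
  by move=> y ny; rewrite (negPf ny) andbF.
rewrite -big_split -sum1_card [X in _ <= X]big_mkcond; apply: leq_sum => w _ /=; rewrite inE /sym.
case h1: ((v, w) \in L); case h2: ((w, v) \in L) => //=.
- by have := r_anti (rL _ _ h1); rewrite (rL _ _ h2).
- by rewrite (rL _ _ h1).
- by rewrite (rL _ _ h2) orbT.
Qed.

(** A link of [L] is monochromatic and won for 4 pairs out of 10; a link outside [L] is won for at
    least [1 = 4 - 3] of them. *)
Lemma tied_cut (L : {set T * T}) : L \subset linkset r ->
  (forall x y, a x y -> ~~ connect (sym (lrel L)) x y) ->
  exists z : pred T, 3 * (\sum_x a x.1 x.2) + 3 * (\sum_x f x.1 x.2) + 4 * #|linkset r|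
     <= 10 * (\sum_x gain a r f z x) + 3 * #|linkset r :\: L|.
Proof.
move=> hL hno; have symc := sym_connect_sym (symC (lrel L)).
have [||||c [c5 cl _ ca]] := @link_coloring T a (enum L) (connect (sym (lrel L))) id.
- by move=> v; rewrite big_pred1_eq; apply: leq_trans (deg2 v); rewrite leq_add2l ends_nbr.
- move=> x y w; split=> [|h]; first exact: connect0.
  exact: same_connect symc _ _ h _.
- by move=> x y ->; apply: connect0.
- by case=> x y; rewrite mem_enum => h; apply: connect1; rewrite /sym /lrel /= h.
pose K := 3 * (\sum_x a x.1 x.2) + 3 * (\sum_x f x.1 x.2) + 4 * #|linkset r|.
have [|p hp] := @pairs_pigeonhole (fun p => \sum_x gain a r f (fun x => zb false p (c x)) x) (K - 3 * #|linkset r :\: L|).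
  rewrite leq_subLR exchange_big /= /K -!sum1_card.
  rewrite [\sum_(i in linkset r) 1]big_mkcond [\sum_(i in linkset r :\: L) 1]big_mkcond !big_distrr -!big_split.
  apply: leq_sum => -[x y] _ /=; rewrite !inE /=.
  have -> : \sum_(p <- pairs) gain a r f (fun x => zb false p (c x)) (x, y) =
     a x y * \sum_(p <- pairs) (zb false p (c x) && ~~ zb false p (c y)) +
     r x y * \sum_(p <- pairs) (~~ zb false p (c x) && ~~ zb false p (c y)) +
     f x y * \sum_(p <- pairs) (zb false p (c x) && zb false p (c y)).
    rewrite !big_distrr -!big_split; apply: eq_bigr => p _ /=.
    by rewrite /gain /again /rgain /fgain /= !mulnb.
  have ha : 3 * a x y <= a x y * \sum_(p <- pairs) (zb false p (c x) && ~~ zb false p (c y)).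
    by case axy: (a x y) => //; rewrite sum_zb10 // ca // hno.
  have hf : 3 * f x y <= f x y * \sum_(p <- pairs) (zb false p (c x) && zb false p (c y)).
    by case: (f x y) => //; rewrite mul1n sum_zb11.
  have hr : 4 * (if r x y then 1 else 0) <= 3 * (if ((x, y) \notin L) && r x y then 1 else 0) +
     r x y * \sum_(p <- pairs) (~~ zb false p (c x) && ~~ zb false p (c y)).
    case rxy: (r x y); rewrite ?andbF // andbT mul1n.
    have [h|h] := boolP ((x, y) \in L) => /=.
      have -> : c y = c x by have := cl (x, y); rewrite mem_enum => /(_ h) /= ->.
      by under eq_bigr do rewrite andbb; rewrite sum_zb0.
    by have := sum_zb00 (c5 x) (c5 y); lia.
  move: ha hf hr; move: (a x y * _) (f x y * _) (r x y * _) => A B C.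
  move: (nat_of_bool (a x y)) (nat_of_bool (f x y)) (if r x y then 1 else 0) (if _ && _ then 1 else 0) => a1 f1 r1 l1; clear; lia.
by exists (fun x => zb false p (c x)); rewrite -/K; move: hp; clear; lia.
Qed.

End Tied.

(** * Finite verification for a single block of two links *)

Fixpoint compositions k n : seq (seq nat) :=
  if k is k'.+1 then flatten [seq [seq i :: l | l <- compositions k' (n - i)] | i <- iota 0 n.+1]
  else if n == 0 then [:: [::]] else [::].

Lemma mem_compositions l : l \in compositions (size l) (sumn l).
Proof.
elim: l => // i l IH.
have -> : compositions (size (i :: l)) (sumn (i :: l)) = flatten [seq [seq j :: l' |
  l' <- compositions (size l) (i + sumn l - j)] | j <- iota 0 (i + sumn l).+1] by [].
apply/flattenP.
exists [seq i :: l' | l' <- compositions (size l) (i + sumn l - i)].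
  by apply/mapP; exists i => //; rewrite mem_iota; lia.
by rewrite addnC addnK; apply: map_f.
Qed.

Definition ones q p (k : seq nat) := sumn [seq if zb q p i then nth 0 k i else 0 | i <- iota 0 5].
Definition zeros q p (k : seq nat) := sumn [seq if zb q p i then 0 else nth 0 k i | i <- iota 0 5].
(** The number of pairs, out of ten, that give a colour the value 0. *)
Definition lam (q : bool) := if q then 6 else 4.

(** [h] is ten times a mean gain and 20 stands for the sure gain 2 of the value (0, 0); truncated
    subtraction models falling back on that value. *)
Definition surplus (h : bool -> nat * nat -> nat) :=
  sumn [seq 7 * (h false p - 20) + 3 * (h true p - 20) | p <- pairs].

(* For a block [v0; v1] closed by an arc u -> v0: ten times the expected gain of the best of the values
   (1, 1), (0, 1), (1, 0) for (v0, v1), given the pair drawn on the side of [v1] in [bestC] and on the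
   side of [v0] and [u] in [bestE].  [k] lists the numbers of out-neighbours and [g] of forward edges by
   colour, [n] and [f] are those numbers on the other side.  The value (0, 0) always gains 2. *)
Definition bestC (k1 g0 : seq nat) n0 f1 q p :=
  maxn (10 * (zeros q p k1 + ones q p g0) + lam q * n0 + (10 - lam q) * f1)
    (maxn (10 * zeros q p k1 + (10 - lam q) * f1.+1) (lam q * n0.+1 + 10 * ones q p g0)).

Definition bestE (k0 g1 : seq nat) u n1 f0 q p :=
  maxn (10 * (zeros q p k0 + ones q p g1) + lam q * n1 + (10 - lam q) * f0)
    (maxn (lam q * n1 + 10 * (ones q p g1 + zb q p u)) (10 * (~~ zb q p u + zeros q p k0) + (10 - lam q) * f0)).

(** [n1], [f1] count out-arcs and forward edges at [v1], and [n0], [f0] those at [v0]. The target is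
    [980 + 300 * (n1 + f1 + n0 + f0)] with [980 = 220 * 2 + 540], and a rule secures 2000 plus its
    surplus; hence 1020. *)
Definition okC n1 f1 n0 f0 := all (fun k1 => all (fun g0 =>
  300 * (n1 + f1 + n0 + f0) <= 1020 + surplus (bestC k1 g0 n0 f1)) (compositions 5 f0)) (compositions 5 n1).

Definition okE n1 f1 n0 f0 := all (fun k0 => all (fun g1 => all (fun u =>
  300 * (n1 + f1 + n0 + f0) <= 1020 + surplus (bestE k0 g1 u n1 f0)) (iota 0 5))
    (compositions 5 f1)) (compositions 5 n0).

(** The first bound holds when the block is not reducible, the second when the constant 1 falls
    short. The last two are [side_min] at [v1], which has two links, and at [v0], which has one. *)
Definition in_range n1 f1 n0 f0 :=
  [&& 4 <= n1 + n0 + (f1 + f0), 16 * (n1 + n0) + 24 * (f1 + f0) < 98,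
    (2 < n1 + f1) || (1 < n1) & (2 < n0 + f0) || (0 < n0)].


Lemma table : all (fun n1 => all (fun f1 => all (fun n0 => all (fun f0 =>
    if in_range n1 f1 n0 f0 then if okC n1 f1 n0 f0 then true else okE n1 f1 n0 f0 else true)
  (iota 0 7)) (iota 0 7)) (iota 0 7)) (iota 0 7).
Proof. by vm_compute. Qed.

Lemma table_spec n1 f1 n0 f0 : in_range n1 f1 n0 f0 -> okC n1 f1 n0 f0 || okE n1 f1 n0 f0.
Proof.
move=> h; have m k : k < 7 -> k \in iota 0 7 by rewrite mem_iota.
have [h1 h2 h3 h4] : [/\ n1 < 7, f1 < 7, n0 < 7 & f0 < 7] by case/and4P: h; split; lia.
have := table => /allP/(_ n1 (m _ h1))/allP/(_ f1 (m _ h2))/allP/(_ n0 (m _ h3))/allP/(_ f0 (m _ h4)).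
by rewrite h; case: (okC _ _ _ _).
Qed.

Lemma surplus_sum h : \sum_(p <- pairs) (7 * maxn 20 (h false p) + 3 * maxn 20 (h true p)) = 2000 + surplus h.
Proof. by rewrite /surplus sumnE big_map -[2000]/(10 * 200) -sum_pairs_const -big_split; apply: eq_bigr => p _ /=; lia. Qed.

(** * Many loops: the bodies choose their values after the draw *)

Section Cluster.
Variables (T : finType) (s : pred T) (a r f : rel T) (c : T -> nat).
Hypothesis a_same : forall x y, a x y -> s x = s y.
Hypothesis r_cross : forall x y, r x y -> s x != s y.
Hypothesis f_cross : forall x y, f x y -> s x != s y.
Hypothesis r_anti : forall x y, r x y -> ~~ r y x.
Hypothesis f_anti : forall x y, f x y -> ~~ f y x.
Hypothesis deg2 : forall v, inarcs a v + #|nbr r v| <= 2.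
Hypothesis side_min : forall v,
  #|[set w | a v w]| + #|nbr f v| <= 2 -> #|nbr r v| <= #|[set w | a v w]|.
Hypothesis c5 : forall x, c x < 5.

Definition comb (W : {set T}) (d z : pred T) : pred T := fun x => if x \in W then d x else z x.

(** What a vertex [x] of [W] with value 1 wins on its edges to the outside of [W]. *)
Definition vgain (W : {set T}) (z : pred T) x :=
  \sum_(y in ~: W) (a x y * ~~ z y + sym f x y * z y).

Section Counts.
Variables (X : {set T}) (pp : T -> seq T).
Hypothesis fam : block_family a r X pp.
Let W := bodies X pp.
Let N := \sum_(x in W) \sum_(y in ~: W) a x y.
Let F := \sum_(x in W) \sum_(y in ~: W) sym f x y.
Let e := \sum_(x in W) \sum_(y in W) f x y.
Let S := \sum_(v in X) size (pp v).

(** [dec] may depend on the whole draw; it replaces the random values on the bodies only. *)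
Definition played (dec : bool -> nat * nat -> nat * nat -> pred T) :=
  Ex (fun q p p' => \sum_(x | touch W x) gain a r f (comb W (dec q p p') (zside s c q p p')) x).

Lemma sym_sum (h : rel T) : (forall x y, h x y -> ~~ h y x) -> forall x y, h x y + h y x = sym h x y.
Proof.
move=> ha x y; rewrite /sym; case h1: (h x y); case h2: (h y x) => //.
by have := ha _ _ h1; rewrite h2.
Qed.

Lemma touch_f : \sum_(x | touch W x) f x.1 x.2 = e + F.
Proof.
rewrite touch_sum /=; congr (_ + _); apply: eq_bigr => x _; apply: eq_bigr => y _; exact: sym_sum.
Qed.

(** No arc joins two vertices of bodies, and only the closing arc of each block enters one. *)
Lemma touch_a : \sum_(x | touch W x) a x.1 x.2 <= #|X| + N.
Proof.
rewrite touch_sum /= big1 => [|x xW]; last first.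
  rewrite big1 // => y yW; case axy: (a x y) => //.
  by have [_ _] := arc_into_bodies deg2 fam axy yW; rewrite xW.
under eq_bigr do rewrite big_split /=.
by rewrite big_split /= add0n [X in X <= _]addnC leq_add2r; exact: (family_incount deg2 fam).
Qed.

Lemma touch_r : \sum_(x | touch W x) r x.1 x.2 <= S.
Proof. exact: (family_rcount r_anti deg2 fam). Qed.

(** A link changes sides and the closing arc does not, so a single link cannot be closed. *)
Lemma size_block v : v \in X -> 2 <= size (pp v).
Proof.
move=> hv; have bv := fam_block fam hv; have := block_size bv.
case: (pp v) bv => [|w [|]] //= bv _.
case/and4P: bv => /= /andP[/orP rw _] _ _ aw.
by have := a_same aw; case: rw => /r_cross; rewrite ?(eq_sym (s v)) => /eqP n /n.
Qed.

Lemma S_ge : 2 * #|X| <= S.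
Proof. by rewrite -sum1_card big_distrr; apply: leq_sum => v /size_block. Qed.

Lemma zero_gain (d z : pred T) : (forall x, x \in W -> ~~ d x) ->
  S <= \sum_(x | touch W x) gain a r f (comb W d z) x.
Proof.
move=> hd; apply: (family_zero_gain f deg2 fam) => x xW.
by rewrite /comb xW hd.
Qed.

Lemma one_gain (d z : pred T) : (forall x, x \in W -> d x) ->
  e + \sum_(x in W) vgain W z x <= \sum_(x | touch W x) gain a r f (comb W d z) x.
Proof.
move=> hd; rewrite touch_sum; apply: leq_add.
  apply: leq_sum => x xW; apply: leq_sum => y yW.
  by rewrite /gain /fgain /comb /= xW yW !hd // !andbT leq_addl.
apply: leq_sum => x xW; apply: leq_sum => y; rewrite inE => yW.
rewrite /gain /again /rgain /fgain /comb /= xW (negPf yW) hd // -(sym_sum f_anti).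
by case: (a x y) => //; case: (f x y) => //; case: (f y x) => //; case: (z y) => //=; rewrite ?addn0 ?leq_addr ?leq_addl //; lia.
Qed.

Lemma Ex_vgain (k : bool -> nat) :
  Ex (fun q p p' => k q * (\sum_(x in W) vgain W (zside s c q p p') x)) =
  (280 * k false + 180 * k true) * N + (420 * k false + 120 * k true) * F.
Proof.
rewrite (@Ex_eq _ (fun q p p' => \sum_(x in W) \sum_(y in ~: W)
   (a x y * (k q * ~~ zside s c q p p' y) + sym f x y * (k q * zside s c q p p' y)))); last first.
  move=> q p p'; rewrite big_distrr; apply: eq_bigr => x _.
  by rewrite /vgain big_distrr; apply: eq_bigr => y _ /=; nia.
rewrite Ex_sum /N /F !big_distrr -big_split; apply: eq_bigr => x _.
rewrite Ex_sum !big_distrr -big_split; apply: eq_bigr => y _ /=.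
rewrite ExD !ExM (Ex_zside s c5 (fun q b => k q * ~~ b)) (Ex_zside s c5 (fun q b => k q * b)) /=.
by rewrite !muln0 !muln1 ?addn0 ?add0n; lia.
Qed.

(** An outside vertex has value 0 with weight [70 * 4 + 30 * 6 = 460] and value 1 with weight
    540. *)
Lemma play_one : 460 * N + 540 * F + 1000 * e <= played (fun _ _ _ _ => true).
Proof.
have le q p p' := @one_gain (fun=> true) (zside s c q p p') (fun _ _ => isT).
apply: leq_trans (Ex_le le).
rewrite ExD Ex_const; have := Ex_vgain (fun=> 1).
rewrite (@Ex_eq _ (fun q p p' => \sum_(x in W) vgain W (zside s c q p p') x)) => [|q p p']; last by rewrite mul1n.
by move->; lia.
Qed.

(** When [q] is true, zeros prevail outside and value 1 on the bodies wins more out-arcs; otherwise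
    value 0 secures [S]. *)
Lemma play_phase : 700 * S + 180 * N + 120 * F + 300 * e <= played (fun q _ _ _ => q).
Proof.
have le q p p' : (~~ q) * S + (q * e + q * (\sum_(x in W) vgain W (zside s c q p p') x)) <=
   \sum_(x | touch W x) gain a r f (comb W (fun=> q) (zside s c q p p')) x.
  case: q => /=; first by rewrite !mul1n; apply: one_gain.
  by rewrite !mul0n !addn0 mul1n; apply: zero_gain.
apply: leq_trans (Ex_le le); rewrite !ExD Ex_vgain.
by rewrite (Ex_q (fun q => ~~ q * S)) (Ex_q (fun q => q * e)) /=; lia.
Qed.

Lemma body_link x : x \in W -> 0 < #|nbr r x|.
Proof.
case/in_bodies => v hv; have bv := fam_block fam hv => /bodyP[i hi ->].
by apply/card_gt0P; exists (nth v (v :: pp v) i.+1); rewrite inE; apply: block_link bv _ hi.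
Qed.

Lemma nbr_f_le x : x \in W -> #|nbr f x| <= e + F.
Proof.
move=> xW; rewrite -sum1_card big_mkcond /= (bigID (mem W)) /=; apply: leq_add; last first.
  rewrite /F [X in _ <= X](bigD1 x) //=; apply: (leq_trans _ (leq_addr _ _)).
  rewrite big_mkcond [X in _ <= X]big_mkcond; apply: leq_sum => y _; rewrite !inE.
  by case: (y \in W); case: (sym f x y).
have fxx : f x x = false by apply/negP => h; have := f_cross h; rewrite eqxx.
rewrite /e [X in _ <= X](bigD1 x) //=.
apply: (@leq_trans (\sum_(y in W) f x y + \sum_(y in W | y != x) f y x)).
  rewrite [X in _ + X]big_mkcondr -big_split; apply: leq_sum => y _ /=; rewrite inE /sym.
  by case: eqP => [->|_] /=; rewrite ?fxx //; case: (f x y); case: (f y x).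
rewrite leq_add2l; apply: leq_sum => y _; by rewrite (bigD1 x) //= leq_addr.
Qed.


Lemma arc_out x y : x \in W -> a x y -> y \in ~: W.
Proof.
move=> xW axy; rewrite inE; apply/negP => /(arc_into_bodies deg2 fam axy)[_ _].
by rewrite xW.
Qed.

Lemma card_arcs x : x \in W -> #|[set w | a x w]| = \sum_(y in ~: W) a x y.
Proof.
move=> xW; rewrite -sum1_card big_mkcond [RHS]big_mkcond; apply: eq_bigr => y _; rewrite inE.
by case axy: (a x y); [rewrite (arc_out xW axy)|case: ifP].
Qed.

Definition side_arcs b := \sum_(x in W) \sum_(y in ~: W) (s y == b) * a x y.
Definition side_f b := \sum_(x in W) \sum_(y in ~: W) (s y == b) * sym f x y.
Definition side_gain b q p := \sum_(x in W) \sum_(y in ~: W)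
  (s y == b) * (a x y * ~~ zb q p (c y) + sym f x y * zb q p (c y)).

Lemma side_arcs_sum : side_arcs true + side_arcs false = N.
Proof.
rewrite -big_split; apply: eq_bigr => x _; rewrite -big_split; apply: eq_bigr => y _ /=.
by case: (s y) => /=; lia.
Qed.

Lemma side_f_sum : side_f true + side_f false = F.
Proof.
rewrite -big_split; apply: eq_bigr => x _; rewrite -big_split; apply: eq_bigr => y _ /=.
by case: (s y) => /=; lia.
Qed.

Lemma side_gain_split q p p' :
  \sum_(x in W) vgain W (zside s c q p p') x = side_gain true q p + side_gain false q p'.
Proof.
rewrite -big_split; apply: eq_bigr => x _; rewrite -big_split; apply: eq_bigr => y _ /=.
by rewrite /zside; case: (s y) => /=; lia.
Qed.

Lemma side_gain_sum b q :
  \sum_(p <- pairs) side_gain b q p = lam q * side_arcs b + (10 - lam q) * side_f b.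
Proof.
rewrite exchange_big !big_distrr -big_split; apply: eq_bigr => x _ /=.
rewrite exchange_big !big_distrr -big_split; apply: eq_bigr => y _ /=.
rewrite -big_distrr big_split -!big_distrr /= sum_zb0 // sum_zb1 //.
by case: q; case: (s y == b); rewrite /lam /=; lia.
Qed.

(** The first two vertices of a path lie in the body and on opposite sides. The one on side [b] has
    few forward edges, so without an out-arc minimality of the sides would leave it no link. *)
Lemma side_arcs_ge b : e + F <= 2 -> #|X| <= side_arcs b.
Proof.
move=> hf; pose h v := if s v == b then v else nth v (v :: pp v) 1.
have hb v : v \in X -> h v \in body v (pp v).
  move=> hv; rewrite /h; case: ifP => _; first exact: head_in_body (fam_block fam hv).
  by apply/bodyP; exists 1 => //; apply: size_block.
have hW v : v \in X -> h v \in W by move=> hv; apply/in_bodies; exists v => //; apply: hb.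
have sh v : v \in X -> s (h v) = b.
  move=> hv; rewrite /h; case: (eqVneq (s v) b) => // nb.
  have := block_link (fam_block fam hv) (block_size (fam_block fam hv)) => /=.
  by case/orP => /r_cross; clear hb hW h; move: nb; case: (s v); case: (s _); case: b.
have inj : {in X &, injective h}.
  move=> v w hv hw e1; apply: (body_unique fam hv hw (hb v hv)); rewrite e1; exact: hb.
have hout v : v \in X -> 0 < \sum_(y in ~: W) (s y == b) * a (h v) y.
  move=> hv; have xW := hW v hv.
  have : 0 < #|[set w | a (h v) w]|.
    rewrite lt0n; apply/negP => /eqP e0; have := side_min (v := h v); rewrite e0 add0n.
    by move=> /(_ (leq_trans (nbr_f_le xW) hf)); rewrite leqNgt body_link.
  case/card_gt0P => y; rewrite inE => axy; rewrite (bigD1 y) ?(arc_out xW axy) //=.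
  by rewrite axy -(a_same axy) sh // eqxx.
apply: (@leq_trans (\sum_(v in X) \sum_(y in ~: W) (s y == b) * a (h v) y)).
  by rewrite -sum1_card; apply: leq_sum => v /hout.
rewrite /side_arcs -(big_imset (fun x => \sum_(y in ~: W) (s y == b) * a x y) inj) /=.
rewrite big_mkcond [X in _ <= X]big_mkcond; apply: leq_sum => x _.
by case: ifP => // /imsetP[v hv ->]; rewrite hW.
Qed.

(* For [q = false] both constants are worth 4 on average.  The mean gain from the neighbours of one
   side is not an integer, so that knowing this gain before choosing between them is profitable. *)
Lemma play_pair : #|X| = 2 -> S = 4 -> e = 1 -> N = 6 -> F = 1 ->
  exists dec, 4370 <= played dec.
Proof.
move=> cX eS ee eN eF; have hef : e + F <= 2 by rewrite ee eF.
have := side_arcs_ge true hef; have := side_arcs_ge false hef; rewrite cX => hnf hnt.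
have hn := side_arcs_sum; have hf := side_f_sum; rewrite eN in hn; rewrite eF in hf.
(* Ten times the mean of [side_gain true false p] over the ten pairs. *)
pose mu := 4 * side_arcs true + 6 * side_f true.
exists (fun q p _ _ => q || (mu <= 10 * side_gain true false p)).
pose g q p p' := if q || (mu <= 10 * side_gain true false p)
  then 1 + (side_gain true q p + side_gain false q p') else 4.
apply: (@leq_trans (Ex g)); last first.
  apply: Ex_le => q p p'; rewrite /g /=; case: (q || _).
    by have := @one_gain (fun=> true) (zside s c q p p') (fun _ _ => isT); rewrite ee side_gain_split.
  by have := @zero_gain (fun=> false) (zside s c q p p') (fun _ _ => isT); rewrite eS.
have gf p : 40 + (10 * side_gain true false p - mu) <= \sum_(p' <- pairs) g false p p'.
  rewrite /g /=; case: (leqP mu (10 * side_gain true false p)) => h; last by rewrite sum_pairs_const; lia.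
  rewrite !big_split /= !sum_pairs_const side_gain_sum /lam; lia.
have gt p : \sum_(p' <- pairs) g true p p' =
  10 + 10 * side_gain true true p + (6 * side_arcs false + 4 * side_f false).
  by rewrite /g /= !big_split /= !sum_pairs_const side_gain_sum /lam; lia.
have e1 := side_gain_sum true false; have e2 := side_gain_sum true true.
rewrite /lam /= in e1 e2.
have hpm : \sum_(p <- pairs) (10 * side_gain true false p + (mu - 10 * side_gain true false p)) =
   \sum_(p <- pairs) (mu + (10 * side_gain true false p - mu)).
  by apply: eq_bigr => p _; lia.
rewrite [LHS]big_split [RHS]big_split /= -big_distrr /= e1 sum_pairs_const in hpm.
(* [mu] is 8, 12 or 16, plus 6 if the outer end of the forward edge is on this side: even and never
   a multiple of 10. So each deviation is at least 2; half of their total is positive, which adds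
   [7 * 10] to 4300. *)
have hab : \sum_(p <- pairs) 2 <= \sum_(p <- pairs)
   ((mu - 10 * side_gain true false p) + (10 * side_gain true false p - mu)).
  by apply: leq_sum => p _; rewrite /mu; lia.
rewrite big_split sum_pairs_const /= in hab.
apply: (@leq_trans (\sum_(p <- pairs) (7 * (40 + (10 * side_gain true false p - mu)) +
   3 * (10 + 10 * side_gain true true p + (6 * side_arcs false + 4 * side_f false))))).
  rewrite big_split -!big_distrr /=.
  rewrite [\sum_(p <- pairs) (40 + _)]big_split [\sum_(p <- pairs) (10 + _ + _)]big_split /=.
  rewrite [\sum_(p <- pairs) (10 + _)]big_split /= !sum_pairs_const -big_distrr /= e2.
  by move: hpm hab; rewrite /mu; lia.
rewrite /Ex; apply: leq_sum => p _; rewrite big_split -!big_distrr /= gt leq_add2r leq_mul2l.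
exact: gf.
Qed.

Definition column (h : T -> nat) := [seq \sum_(y in ~: W | c y == i) h y | i <- iota 0 5].

Lemma sum_by_color (h : T -> nat) (g : nat -> bool) :
  \sum_(y in ~: W) h y * g (c y) = sumn [seq if g i then nth 0 (column h) i else 0 | i <- iota 0 5].
Proof.
rewrite sumnE big_map (eq_big_seq (fun i => \sum_(y in ~: W) (c y == i) * (h y * g i))); last first.
  move=> i hi; rewrite /column (nth_map 0) ?size_iota; last by rewrite mem_iota in hi.
  rewrite nth_iota ?add0n; last by rewrite mem_iota in hi.
  rewrite big_mkcondr; case: (g i).
    by apply: eq_bigr => y _; rewrite muln1; case: eqP; rewrite ?mul1n ?mul0n.
  by rewrite big1 // => y _; rewrite !muln0.
rewrite exchange_big; apply: eq_bigr => y _; move: (c5 y).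
rewrite !big_cons big_nil /=.
by case: (c y) => [|[|[|[|[|i]]]]] // _; rewrite ?mul0n ?mul1n ?add0n ?addn0.
Qed.

Lemma column_zeros (h : T -> nat) q p : \sum_(y in ~: W) h y * ~~ zb q p (c y) = zeros q p (column h).
Proof.
rewrite (sum_by_color h (fun i => ~~ zb q p i)) /zeros; congr sumn.
by apply: eq_map => i; case: (zb q p i).
Qed.

Lemma column_ones (h : T -> nat) q p : \sum_(y in ~: W) h y * zb q p (c y) = ones q p (column h).
Proof. exact: (sum_by_color h (fun i => zb q p i)). Qed.

Lemma sumn_column (h : T -> nat) : sumn (column h) = \sum_(y in ~: W) h y.
Proof.
transitivity (\sum_(y in ~: W) h y * true); last by apply: eq_bigr => y _; rewrite muln1.
by rewrite (sum_by_color h (fun=> true)).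
Qed.

Lemma column_compositions (h : T -> nat) : column h \in compositions 5 (\sum_(y in ~: W) h y).
Proof. by rewrite -sumn_column; apply: (mem_compositions (column h)). Qed.

Definition arcs_out x := \sum_(y in ~: W) a x y.
Definition f_out x := \sum_(y in ~: W) sym f x y.

(** With the pair of the side of [x] fixed and the other averaged, arcs depend on the fixed pair and
    forward edges on the averaged one; in [sum_vgain_cross] the roles are exchanged. *)
Lemma sum_vgain_same q p x :
  \sum_(p' <- pairs) vgain W (zside s c q (swap (s x) p p') (swap (s x) p' p)) x =
  10 * zeros q p (column (fun y => a x y)) + (10 - lam q) * f_out x.
Proof.
transitivity (\sum_(p' <- pairs) (\sum_(y in ~: W) a x y * ~~ zb q p (c y) +
   \sum_(y in ~: W) sym f x y * zb q p' (c y))).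
  apply: eq_bigr => p' _; rewrite -big_split; apply: eq_bigr => y _ /=; rewrite zside_swap.
  congr (_ + _); first by case axy: (a x y) => //; rewrite -(a_same axy) eqxx.
  case fxy: (sym f x y) => //; have : s x != s y by case/orP: fxy => /f_cross //; rewrite eq_sym.
  by rewrite eq_sym => /negPf ->.
rewrite big_split sum_pairs_const column_zeros; congr (_ + _).
rewrite exchange_big /f_out big_distrr; apply: eq_bigr => y _.
by rewrite -big_distrr /= sum_zb1 // mulnC; case: q.
Qed.

Lemma sum_vgain_cross b q p x : s x != b ->
  \sum_(p' <- pairs) vgain W (zside s c q (swap b p p') (swap b p' p)) x =
  lam q * arcs_out x + 10 * ones q p (column (fun y => sym f x y)).
Proof.
move=> nb; transitivity (\sum_(p' <- pairs) (\sum_(y in ~: W) a x y * ~~ zb q p' (c y) +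
   \sum_(y in ~: W) sym f x y * zb q p (c y))).
  apply: eq_bigr => p' _; rewrite -big_split; apply: eq_bigr => y _ /=; rewrite zside_swap.
  congr (_ + _); first by case axy: (a x y) => //; rewrite -(a_same axy) (negPf nb).
  case fxy: (sym f x y) => //; have : s x != s y by case/orP: fxy => /f_cross //; rewrite eq_sym.
  by move: nb; case: (s x); case: (s y); case: b.
rewrite big_split sum_pairs_const column_ones; congr (_ + _).
rewrite exchange_big /arcs_out big_distrr; apply: eq_bigr => y _.
by rewrite -big_distrr /= sum_zb0 // mulnC; case: q.
Qed.

(** * One block with two links, on the path [v], [w], [u] *)

Section Single.
Variables (v w u : T).
Hypothesis eX : X = [set v].
Hypothesis epp : pp v = [:: w; u].
Hypothesis e0 : e = 0.

Let vX : v \in X. Proof. by rewrite eX set11. Qed.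
Let bv : block a r v [:: w; u]. Proof. by rewrite -epp; apply: fam_block fam _ vX. Qed.
Let eW : W = [set v; w].
Proof. by rewrite /W /bodies eX big_set1 epp; apply/setP => x; rewrite !inE. Qed.
Let vW : v \in W. Proof. by rewrite eW !inE eqxx. Qed.
Let wW : w \in W. Proof. by rewrite eW !inE eqxx orbT. Qed.
Let uW : u \in ~: W. Proof. by have := last_notin fam vX; rewrite epp inE. Qed.
Let nvw : v != w.
Proof. by case/and4P: bv => _ /=; rewrite !inE negb_or => /andP[/andP[]]. Qed.
Let auv : a u v. Proof. by case/and4P: bv. Qed.
Let rvw : sym r v w. Proof. by case/and4P: bv => /= /and3P[]. Qed.
Let rwu : sym r w u. Proof. by case/and4P: bv => /= /and3P[]. Qed.
Let sv : s v != s w. Proof. by case/orP: rvw => /r_cross //; rewrite eq_sym. Qed.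
Let su : s u = s v. Proof. exact: a_same auv. Qed.

Lemma sumW (g : T -> nat) : \sum_(x in W) g x = g v + g w.
Proof. by rewrite eW big_setU1 ?inE // big_set1. Qed.

(** [d] gives the values of [v] and [w]. The term [z u] is the closing arc won, and [~~ z u] the
    link between [w] and [u]. *)
Definition single_value (z : pred T) (d : bool * bool) :=
  match d with
  | (false, false) => 2
  | (true, true) => vgain W z v + vgain W z w
  | (false, true) => vgain W z w + z u
  | (true, false) => ~~ z u + vgain W z v
  end.

Definition single_play (d : bool * bool) : pred T := fun x => if x == v then d.1 else d.2.

Lemma single_gain z d :
  single_value z d <= \sum_(x | touch W x) gain a r f (comb W (single_play d) z) x.
Proof.
case: d => -[] [].
- have := @one_gain (single_play (true, true)) z; rewrite sumW e0; apply=> x _.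
  by rewrite /single_play; case: ifP.
- rewrite touch_sum; apply: leq_trans (leq_addl _ _); rewrite sumW addnC /=; apply: leq_add.
    rewrite (bigD1 u) //=; apply: leq_trans (leq_addr _ _); have := uW; rewrite inE => /negPf nu.
    rewrite /gain /again /rgain /fgain /comb /= wW nu /single_play eq_sym (negPf nvw) /=.
    by case/orP: rwu => ->; case: (z u) => //=; clear; lia.
  rewrite /vgain; apply: leq_sum => y; rewrite inE => yW.
  rewrite /gain /again /rgain /fgain /comb /= vW (negPf yW) /single_play eqxx /= -(sym_sum f_anti).
  by case: (a v y) => //; case: (f v y) => //; case: (f y v) => //; case: (z y) => //=; clear; lia.
- rewrite touch_sum; apply: leq_trans (leq_addl _ _); rewrite sumW addnC /=; apply: leq_add.
    rewrite /vgain; apply: leq_sum => y; rewrite inE => yW.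
    rewrite /gain /again /rgain /fgain /comb /= wW (negPf yW) /single_play eq_sym (negPf nvw) /= -(sym_sum f_anti).
    by case: (a w y) => //; case: (f w y) => //; case: (f y w) => //; case: (z y) => //=; clear; lia.
  rewrite (bigD1 u) //=; apply: leq_trans (leq_addr _ _); have := uW; rewrite inE => /negPf nu.
  rewrite /gain /again /rgain /fgain /comb /= vW nu /single_play eqxx /= auv.
  by case: (z u) => //=; clear; lia.
- have := @zero_gain (single_play (false, false)) z; rewrite /S eX big_set1 epp /=; apply=> x _.
  by rewrite /single_play; case: ifP.
Qed.

(** The choice is made knowing [q] and the pair of side [b], so only means over the other pair are
    compared. *)
Lemma single_rule b (M : bool -> nat * nat -> nat) :
  (forall q p, exists d, M q p <=
     \sum_(p' <- pairs) single_value (zside s c q (swap b p p') (swap b p' p)) d) ->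
  exists dec, \sum_(p <- pairs) (7 * M false p + 3 * M true p) <= played dec.
Proof.
move=> hM; pose D q p := xchoose (hM q p); have hD q p := xchooseP (hM q p).
exists (fun q p p' => single_play (D q (swap b p p'))).
rewrite /played -(Ex_swap b) /Ex; apply: leq_sum => p _.
rewrite big_split -!big_distrr /=.
apply: leq_add; rewrite leq_mul2l /=; apply: leq_trans (hD _ p) _; apply: leq_sum => p' _;
  by rewrite swapK; apply: single_gain.
Qed.

Lemma sum_zside q b p x : \sum_(p' <- pairs) zside s c q (swap b p p') (swap b p' p) x =
  if s x == b then 10 * zb q p (c x) else 10 - lam q.
Proof.
transitivity (\sum_(p' <- pairs) zb q (swap (s x == b) p p') (c x)).
  by apply: eq_bigr => p' _; rewrite zside_swap.
by case: ifP => _; rewrite /= ?sum_pairs_const // sum_zb1 //; case: q.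
Qed.

Lemma sum_nzside q b p x : \sum_(p' <- pairs) ~~ zside s c q (swap b p p') (swap b p' p) x =
  if s x == b then 10 * ~~ zb q p (c x) else lam q.
Proof.
transitivity (\sum_(p' <- pairs) ~~ zb q (swap (s x == b) p p') (c x)).
  by apply: eq_bigr => p' _; rewrite zside_swap.
by case: ifP => _; rewrite /= ?sum_pairs_const // sum_zb0 //; case: q.
Qed.

Lemma max4P (P : nat -> Prop) k l m n : P l -> P m -> P n -> P k -> P (maxn k (maxn l (maxn m n))).
Proof. by move=> *; rewrite /maxn; do 3!case: ifP. Qed.

Lemma single_ruleC : exists dec, 2000 + surplus (bestC (column (fun y => a w y))
   (column (fun y => sym f v y)) (arcs_out v) (f_out w)) <= played dec.
Proof.
rewrite -surplus_sum; apply: (@single_rule (s w)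
  (fun q p => maxn 20 (bestC _ _ (arcs_out v) (f_out w) q p))) => q p.
have hw := sum_vgain_same q p w; have hv := sum_vgain_cross q p sv.
have hu : (s u == s w) = false by rewrite su; apply: negPf.
have zu := sum_zside q (s w) p u; have nzu := sum_nzside q (s w) p u; rewrite hu in zu nzu.
rewrite /bestC; apply: (max4P (P := fun x => exists d, x <= _)).
- by exists (true, true); rewrite /= big_split /= hv hw mulnDr; clear; lia.
- by exists (false, true); rewrite /= big_split /= hw zu ?mulnS ?mulnDr; clear; lia.
- by exists (true, false); rewrite /= big_split /= nzu hv ?mulnS ?mulnDr; clear; lia.
- by exists (false, false); rewrite /= sum_pairs_const.
Qed.

Lemma single_ruleE : exists dec, 2000 + surplus (bestE (column (fun y => a v y))
   (column (fun y => sym f w y)) (c u) (arcs_out w) (f_out v)) <= played dec.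
Proof.
rewrite -surplus_sum; apply: (@single_rule (s v)
  (fun q p => maxn 20 (bestE _ _ (c u) (arcs_out w) (f_out v) q p))) => q p.
have sw : s w != s v by rewrite eq_sym.
have hw := sum_vgain_cross q p sw; have hv := sum_vgain_same q p v.
have zu := sum_zside q (s v) p u; have nzu := sum_nzside q (s v) p u; rewrite su eqxx in zu nzu.
rewrite /bestE; apply: (max4P (P := fun x => exists d, x <= _)).
- by exists (true, true); rewrite /= big_split /= hv hw mulnDr; clear; lia.
- by exists (false, true); rewrite /= big_split /= hw zu ?mulnS ?mulnDr; clear; lia.
- by exists (true, false); rewrite /= big_split /= nzu hv ?mulnS ?mulnDr; clear; lia.
- by exists (false, false); rewrite /= sum_pairs_const.
Qed.

(** Minimality of the sides puts the counts in the range of the table, which tells on which side the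
    pair should be known before choosing. *)
Lemma play_single : 4 <= N + F -> 16 * N + 24 * F < 98 ->
  exists dec, 980 + 300 * (N + F) <= played dec.
Proof.
have eN : N = arcs_out w + arcs_out v by rewrite /N sumW addnC.
have eF : F = f_out w + f_out v by rewrite /F sumW addnC.
rewrite eN eF => h1 h2.
have fin x : x \in W -> #|nbr f x| <= f_out x.
  move=> xW; rewrite -sum1_card big_mkcond /f_out [X in _ <= X]big_mkcond; apply: leq_sum => y _.
  rewrite !inE; case: (boolP (y \in W)) => /= yW; last by case: (sym f x y).
  have f0 x' y' : x' \in W -> y' \in W -> f x' y' = false.
    move=> hx hy; apply/negP => fxy; move: e0; rewrite /e (bigD1 x') //= (bigD1 y') //= fxy.
    by clear; lia.
  by rewrite /sym !f0.
have rv : 0 < #|nbr r v| := body_link vW.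
have rw : 2 <= #|nbr r w|.
  have [] := block_nbrS deg2 bv (i := 1) isT => /= -> _.
  rewrite cards2; case: eqP => // e1; by case/and4P: bv => _ /=; rewrite e1 !inE eqxx orbT.
have mv := side_min (v := v); have mw := side_min (v := w).
rewrite (card_arcs vW) -/(arcs_out v) in mv; rewrite (card_arcs wW) -/(arcs_out w) in mw.
have fv := fin v vW; have fw := fin w wW.
have hr : in_range (arcs_out w) (f_out w) (arcs_out v) (f_out v).
  by rewrite /in_range; move: mv mw fv fw rv rw h1 h2; clear; lia.
case/orP: (table_spec hr) => [/allP h|/allP h].
  have /allP/(_ _ (column_compositions _)) h' := h _ (column_compositions (fun y => a w y)).
  have [dec hdec] := single_ruleC; exists dec; move: h' hdec; clear; lia.
have /allP h' := h _ (column_compositions (fun y => a v y)).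
have /allP/(_ (c u)) h'' := h' _ (column_compositions (fun y => sym f w y)).
have [dec hdec] := single_ruleE; exists dec; move: hdec h''; rewrite mem_iota /= add0n c5 => hdec /(_ isT).
by move: hdec; clear; lia.
Qed.

End Single.

(** A block is owed 540: 300 for its closing arc and the promised 240 for its loop. Two simple rules
    settle all but two small configurations. *)
Lemma cluster_play : 0 < #|X| -> #|X| <= e.+1 -> 7 * S < 3 * (#|X| + N + e + F) ->
  exists dec, 220 * S + 540 * #|X| + 300 * (N + e + F) <= played dec.
Proof.
move=> h0 he hS; have h2 := S_ge.
have [h|hone] := leqP (220 * S + 540 * #|X| + 300 * (N + e + F)) (460 * N + 540 * F + 1000 * e).
  by exists (fun _ _ _ _ => true); apply: leq_trans h play_one.
have [h|hph] := leqP (220 * S + 540 * #|X| + 300 * (N + e + F)) (700 * S + 180 * N + 120 * F + 300 * e).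
  by exists (fun q _ _ _ => q); apply: leq_trans h play_phase.
(* The only counts for which both simple rules fall short. *)
have [[x1 s2 ee]|[x2 s4 e1 n6 f1]] : [/\ #|X| = 1, S = 2 & e = 0] \/
    [/\ #|X| = 2, S = 4, e = 1, N = 6 & F = 1].
  move: #|X| S N e F h0 he hS h2 hone hph; clear => P S' N' e' F' *.
  have : (P = 1 /\ S' = 2 /\ e' = 0) \/ (P = 2 /\ S' = 4 /\ e' = 1 /\ N' = 6 /\ F' = 1) by lia.
  by case=> [[-> [-> ->]]|[-> [-> [-> [-> ->]]]]]; [left|right].
- have /eqP/cards1P[v eX] := x1; have := s2; rewrite /S eX big_set1.
  case epp: (pp v) => [|w [|u [|? ?]]] //= _; rewrite x1 s2 ee in hS hone *.
  have [||dec hdec] := play_single eX epp ee; last by exists dec; apply: leq_trans hdec; rewrite cards1 addn0.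
    by move: hS; clear; lia.
  by move: hone; clear; lia.
- have [dec hdec] := play_pair x2 s4 e1 n6 f1; exists dec; rewrite x2 s4 e1 n6 f1; exact: leq_trans _ hdec.
Qed.

End Counts.

(* Setting a body to 0 wins enough whatever happens elsewhere, so [W] can be deleted. *)
Definition reducible := exists W : {set T},
  0 < \sum_(x | touch W x) (a x.1 x.2 + r x.1 x.2 + f x.1 x.2) /\
  forall z, 3 * (\sum_(x | touch W x) (a x.1 x.2 + r x.1 x.2 + f x.1 x.2)) <=
    10 * \sum_(x | touch W x) gain a r f (comb W (fun=> false) z) x.

Definition due (x : T * T) := 300 * a x.1 x.2 + 300 * f x.1 x.2 + 220 * r x.1 x.2.

Lemma sum_due (P : pred (T * T)) : \sum_(x | P x) due x = 300 * (\sum_(x | P x) a x.1 x.2) +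
  300 * (\sum_(x | P x) f x.1 x.2) + 220 * (\sum_(x | P x) r x.1 x.2).
Proof. by rewrite !big_distrr -!big_split. Qed.

Lemma gain_congr (z z' : pred T) x : z x.1 = z' x.1 -> z x.2 = z' x.2 ->
  gain a r f z x = gain a r f z' x.
Proof. by move=> e1 e2; rewrite /gain /again /rgain /fgain e1 e2. Qed.

Lemma gain0 z x : a x.1 x.2 + r x.1 x.2 + f x.1 x.2 = 0 -> gain a r f z x = 0.
Proof. by rewrite /gain /again /rgain /fgain; case: (a _ _); case: (r _ _); case: (f _ _). Qed.

Lemma family_sub (X Y : {set T}) pp : Y \subset X -> block_family a r X pp -> block_family a r Y pp.
Proof.
move=> /subsetP sub fam; split=> [v|v w|v w] /sub hv; first exact: (fam_block fam).
  by move/sub; apply: (fam_disj fam).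
by move/sub; apply: (fam_last fam).
Qed.

Definition inner_f (W : {set T}) := [set x : T * T | [&& x.1 \in W, x.2 \in W & f x.1 x.2]].

Lemma inner_fE W : #|inner_f W| = \sum_(x in W) \sum_(y in W) f x y.
Proof.
rewrite pair_big -sum1_card big_mkcond [RHS]big_mkcond; apply: eq_bigr => -[x y] _ /=.
by rewrite inE /=; case: (x \in W); case: (y \in W); case: (f x y).
Qed.

Lemma touch_setU (U V : {set T}) x : touch (U :|: V) x = touch U x || touch V x.
Proof. by rewrite /touch !inE orbACA. Qed.

Lemma bodies_setU (Y Z : {set T}) pp : bodies (Y :|: Z) pp = bodies Y pp :|: bodies Z pp.
Proof. exact: bigcup_setU. Qed.

(** A largest family within the bound works: a forward edge to a further body would allow adding
    that block together with a new inner edge. *)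
Lemma closed_subfamily (X : {set T}) pp v0 : block_family a r X pp -> v0 \in X ->
  exists Y : {set T}, [/\ Y \subset X, v0 \in Y, #|Y| <= #|inner_f (bodies Y pp)|.+1 &
    forall x y, x \in bodies Y pp -> y \in bodies (X :\: Y) pp -> ~~ sym f x y].
Proof.
move=> fam hv0; pose good (Y : {set T}) := [&& Y \subset X, v0 \in Y & #|Y| <= #|inner_f (bodies Y pp)|.+1].
have g0 : good [set v0] by rewrite /good sub1set hv0 set11 cards1.
case: (arg_maxnP (fun Y : {set T} => #|Y|) g0) => Y /and3P[sub vY hY] hmax.
exists Y; split=> // x y xY /in_bodies[w /setDP[wX wY] yw]; apply/negP => fxy.
have yY : y \notin bodies Y pp.
  apply/negP => /in_bodies[v vY' yv]; case/negP: wY.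
  by rewrite -(body_unique fam (subsetP sub _ vY') wX yv yw).
have eB : bodies (w |: Y) pp = body w (pp w) :|: bodies Y pp.
  by rewrite bodies_setU /bodies big_set1.
have : good (w |: Y).
  rewrite /good subUset sub1set wX sub !inE vY orbT cardsU1 wY add1n ltnS.
  apply: leq_trans hY _; apply: proper_card; apply/properP; split.
    by apply/subsetP => p; rewrite in_set [in X in _ -> X]in_set eB !in_setU => /and3P[-> -> ->]; rewrite !orbT.
  have x1 : x \in bodies (w |: Y) pp by rewrite eB in_setU xY orbT.
  have y1 : y \in bodies (w |: Y) pp by rewrite eB in_setU yw.
  case/orP: fxy => fxy; [exists (x, y)|exists (y, x)]; rewrite in_set /= ?x1 ?y1 ?fxy //.
    by rewrite (negPf yY) andbF.
  by rewrite (negPf yY).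
by move/hmax; rewrite /= cardsU1 wY add1n ltnn.
Qed.

(** One closed cluster is split off at a time; it is reducible or can be played on its own. *)
Lemma play_family (X : {set T}) pp : block_family a r X pp -> reducible \/ exists dec,
  \sum_(x | touch (bodies X pp) x) due x + 240 * #|X| <= played X pp dec.
Proof.
have [n] := ubnP #|X|; elim: n X => // n IH X hn fam.
have [->|/set0Pn[v0 hv0]] := eqVneq X set0.
  right; exists (fun _ _ _ _ => false); rewrite cards0 big_pred0 // => x.
  by rewrite /touch /bodies big_set0 !inE.
have [Y [sub vY hY hcl]] := closed_subfamily fam hv0.
have famY := family_sub sub fam; have famZ := family_sub (subsetDl X Y) fam.
have hP : 0 < #|Y| by apply/card_gt0P; exists v0.
set WY := bodies Y pp in hY hcl *; set WZ := bodies (X :\: Y) pp in hcl.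
have hta := touch_a famY; have htr := touch_r famY; have htf := touch_f Y pp.
rewrite inner_fE in hY.
move: hta htr htf hY (@cluster_play Y pp famY hP); rewrite -/WY.
set N := \sum_(x in WY) \sum_(y in ~: WY) a x y; set F := \sum_(x in WY) \sum_(y in ~: WY) sym f x y.
set e := \sum_(x in WY) \sum_(y in WY) f x y; set S := \sum_(v in Y) size (pp v).
move=> hta htr htf hY hplay.
(* Value 0 wins [S] of at most [S + #|Y| + N + e + F] edges, which is a share of 3/10 exactly under
   this inequality. *)
have [hred|hlt] := leqP (3 * (#|Y| + N + e + F)) (7 * S).
  left; exists WY; have av : a (last v0 (pp v0)) v0 by case/and4P: (fam_block famY vY).
  have vW : v0 \in WY by apply/in_bodies; exists v0 => //; apply: head_in_body (fam_block famY vY).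
  split; first by rewrite (bigD1 (last v0 (pp v0), v0)) /= ?av ?addn_gt0 // /touch vW orbT.
  move=> z; have := @zero_gain Y pp famY (fun=> false) z (fun _ _ => isT); rewrite -/WY -/S.
  have arith A R P N' F' e' S' : A <= P + N' -> R <= S' -> 3 * (P + N' + e' + F') <= 7 * S' ->
      3 * (A + R + (e' + F')) <= 10 * S' by clear; lia.
  move=> hG; apply: leq_trans (leq_mul (leqnn 10) hG); rewrite !big_split /= htf.
  exact: arith hta htr hred.
have [dec1 h1] := hplay hY hlt.
have [|red|[dec2 h2]] := IH (X :\: Y) _ famZ.
- move: hn; rewrite ltnS; apply: leq_trans; apply: proper_card; rewrite properE subsetDl /=.
  by apply/subsetPn; exists v0 => //; rewrite !inE vY.
- by left.
right; pose dec q p p' : pred T := fun x => if x \in WY then dec1 q p p' x else dec2 q p p' x.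
have eX : Y :|: (X :\: Y) = X by rewrite -[RHS](setID X Y) (setIidPr sub).
have eW : bodies X pp = WY :|: WZ by rewrite -eX bodies_setU.
have disj x : x \in WY -> x \notin WZ.
  case/in_bodies => v vY' xv; apply/in_bodies => -[w /setDP[wX wY] xw]; case/negP: wY.
  by rewrite -(body_unique fam (subsetP sub _ vY') wX xv xw).
have inX x : x \in bodies X pp = (x \in WY) || (x \in WZ) by rewrite eW inE.
(* The clusters do not interact: a link touches one body, an arc enters a body only from outside all
   bodies, and forward edges are excluded by [hcl]. *)
have sep x : 0 < a x.1 x.2 + r x.1 x.2 + f x.1 x.2 -> touch WY x -> ~~ touch WZ x.
  move=> hx tY; apply/negP => tZ.
  have [v vY' tv] : exists2 v, v \in Y & touch (body v (pp v)) x.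
    by case/orP: tY => /in_bodies[v hv h]; exists v => //; rewrite /touch h ?orbT.
  have [w wZ tw] : exists2 w, w \in X :\: Y & touch (body w (pp w)) x.
    by case/orP: tZ => /in_bodies[w hw h]; exists w => //; rewrite /touch h ?orbT.
  have hr : ~~ r x.1 x.2.
    apply/negP => rx; case/setDP: wZ => wX /negP; apply.
    by rewrite -(link_touch_unique deg2 fam (subsetP sub _ vY') wX rx tv tw).
  have both : (x.1 \in WY) && (x.2 \in WZ) || (x.1 \in WZ) && (x.2 \in WY).
    move: tY tZ; rewrite /touch; have := disj x.1; have := disj x.2.
    by case: (x.1 \in WY); case: (x.2 \in WY); case: (x.1 \in WZ); case: (x.2 \in WZ) => //= h h'; rewrite ?h ?h' //; move: (h isT) (h' isT).
  have ha : ~~ a x.1 x.2.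
    apply/negP => ax; have x2 : x.2 \in bodies X pp by rewrite inX; case/orP: both => /andP[_ ->]; rewrite ?orbT.
    have [_ _] := arc_into_bodies deg2 fam ax x2; rewrite inX.
    by case/orP: both => /andP[-> _]; rewrite ?orbT.
  have hf : ~~ sym f x.1 x.2.
    by case/orP: both => /andP[u1 u2]; [|rewrite symC]; apply: hcl.
  by move: hx hr ha hf; rewrite /sym; case: (a _ _); case: (r _ _); case: (f x.1 _).
exists dec; apply: (@leq_trans (played Y pp dec1 + played (X :\: Y) pp dec2)); last first.
  rewrite /played -ExD; apply: Ex_le => q p p'; rewrite -/WY -/WZ.
  rewrite big_mkcond [X in _ + X]big_mkcond [X in _ <= X]big_mkcond -big_split; apply: leq_sum => x _ /=.
  rewrite eW touch_setU; have [h0|h0] := posnP (a x.1 x.2 + r x.1 x.2 + f x.1 x.2).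
    by rewrite !(gain0 _ h0); do !case: ifP.
  have [tY|tY] := boolP (touch WY x) => /=.
    rewrite (negPf (sep _ h0 tY)) addn0; have := sep _ h0 tY; rewrite negb_or => /andP[n1 n2].
    by rewrite (@gain_congr _ (comb (WY :|: WZ) (dec q p p') (zside s c q p p'))) // /comb /dec !inE ?(negPf n1) ?(negPf n2) orbF; case: ifP.
  case: ifP => // tZ; move: tY; rewrite negb_or => /andP[n1 n2].
  by rewrite (@gain_congr _ (comb (WY :|: WZ) (dec q p p') (zside s c q p p'))) // /comb /dec !inE ?(negPf n1) ?(negPf n2).
have hc : #|X| = #|Y| + #|X :\: Y| by rewrite -(cardsID Y X) (setIidPr sub).
have hd : \sum_(x | touch (bodies X pp) x) due x <= \sum_(x | touch WY x) due x + \sum_(x | touch WZ x) due x.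
  rewrite big_mkcond [X in _ <= X + _]big_mkcond [X in _ <= _ + X]big_mkcond -big_split; apply: leq_sum => x _ /=.
  by rewrite eW touch_setU; case: (touch WY x); case: (touch WZ x) => //=; rewrite ?leq_addr.
have hY' : \sum_(x | touch WY x) due x <= 300 * (#|Y| + N) + 300 * (e + F) + 220 * S.
  rewrite sum_due htf.
  by apply: leq_add; [rewrite leq_add2r leq_mul2l|rewrite leq_mul2l].
have arith D D1 D2 P1 P2 P Z N' F' e' S' : D <= D1 + D2 ->
    D1 <= 300 * (P + N') + 300 * (e' + F') + 220 * S' ->
    220 * S' + 540 * P + 300 * (N' + e' + F') <= P1 -> D2 + 240 * Z <= P2 ->
    D + 240 * (P + Z) <= P1 + P2 by clear; lia.
by rewrite hc; apply: arith hd hY' h1 h2.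
Qed.

(** The late decision affects only pairs touching a body; all other pairs win [due] on average. *)
Lemma free_cut (X : {set T}) pp : block_family a r X pp ->
  (forall x y, a x y -> c x != c y) -> reducible \/ exists z : pred T,
  \sum_x due x + 240 * #|X| <= 1000 * \sum_x gain a r f z x.
Proof.
move=> fam ca; have [red|[dec hdec]] := play_family fam; first by left.
right; pose W := bodies X pp; pose z q p p' := comb W (dec q p p') (zside s c q p p').
have [|q [p [p' h]]] := @Ex_pigeonhole (fun q p p' => 1000 * \sum_x gain a r f (z q p p') x)
  (\sum_x due x + 240 * #|X|); last by exists (z q p p').
rewrite ExM leq_mul2l /=.
rewrite (bigID (touch W)) /= addnAC.
rewrite (@Ex_eq _ (fun q p p' => \sum_(x | touch W x) gain a r f (z q p p') x +
   \sum_(x | ~~ touch W x) gain a r f (zside s c q p p') x)); last first.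
  move=> q p p'; rewrite (bigID (touch W)) /=; congr (_ + _); apply: eq_bigr => x.
  rewrite negb_or => /andP[n1 n2]; apply: gain_congr; rewrite /z /comb ?(negPf n1) ?(negPf n2) //.
rewrite ExD; apply: leq_add; first exact: hdec.
rewrite Ex_sum; apply: leq_sum => x _; rewrite /gain !ExD /due.
have -> : Ex (fun q p p' => again a (zside s c q p p') x) = 300 * a x.1 x.2.
  rewrite /again; case ax: (a x.1 x.2) => /=; last by rewrite Ex_const.
  by rewrite (Ex_same c5 (a_same ax)) // ca.
have -> : Ex (fun q p p' => rgain r (zside s c q p p') x) = 220 * r x.1 x.2.
  rewrite /rgain; case rx: (r x.1 x.2) => /=; last by rewrite Ex_const.
  by rewrite (Ex_cross00 c5 (r_cross rx)).
have -> : Ex (fun q p p' => fgain f (zside s c q p p') x) = 300 * f x.1 x.2.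
  rewrite /fgain; case fx: (f x.1 x.2) => /=; last by rewrite Ex_const.
  by rewrite (Ex_cross11 c5 (f_cross fx)).
by clear; lia.
Qed.

End Cluster.

(** * Choosing between the two colourings *)

Section Core.
Variables (T : finType) (s : pred T) (a r f : rel T).
Hypothesis a_irr : irreflexive a.
Hypothesis a_same : forall x y, a x y -> s x = s y.
Hypothesis r_cross : forall x y, r x y -> s x != s y.
Hypothesis f_cross : forall x y, f x y -> s x != s y.
Hypothesis r_anti : forall x y, r x y -> ~~ r y x.
Hypothesis f_anti : forall x y, f x y -> ~~ f y x.
Hypothesis deg2 : forall v, inarcs a v + #|nbr r v| <= 2.
Hypothesis side_min : forall v,
  #|[set w | a v w]| + #|nbr f v| <= 2 -> #|nbr r v| <= #|[set w | a v w]|.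

(** With [R] links and [B] blocks, [4 * R - 3 * B] is at least [3 * R] if [3 * B <= R]; otherwise
    [240 * B] covers the missing [80 * R]. *)
Lemma mixed_cut : reducible a r f \/ exists z : pred T,
  3 * (\sum_x (a x.1 x.2 + r x.1 x.2 + f x.1 x.2)) <= 10 * \sum_x gain a r f z x.
Proof.
have [Bl [pp [L [fam hL hc hno]]]] := block_family_exists r_anti a_irr deg2.
have eR : #|linkset r| = \sum_x r x.1 x.2.
  by rewrite -sum1_card big_mkcond; apply: eq_bigr => x _; rewrite inE; case: (r _ _).
have [|c c5 cp] := @degenerate_coloring T a id.
  by move=> v; rewrite big_pred1_eq; apply: leq_trans (deg2 v); apply: leq_addr.
have ca x y : a x y -> c x != c y.
  by move=> axy; apply: cp => //; apply: contraTneq axy => ->; rewrite a_irr.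
have eT : \sum_x (a x.1 x.2 + r x.1 x.2 + f x.1 x.2) =
  \sum_x a x.1 x.2 + \sum_x r x.1 x.2 + \sum_x f x.1 x.2 by rewrite !big_split.
have [h|h] := leqP (3 * #|Bl|) #|linkset r|.
  right; have [z hz] := tied_cut f r_anti deg2 hL hno; exists z; rewrite eT -eR.
  have arith A R F B B' G : 3 * A + 3 * F + 4 * R <= 10 * G + 3 * B' -> B' <= B -> 3 * B <= R ->
    3 * (A + R + F) <= 10 * G by clear; lia.
  exact: arith hz hc h.
have [red|[z]] := free_cut a_same r_cross f_cross r_anti f_anti deg2 side_min c5 fam ca.
  by left.
rewrite sum_due -eR => hz; right; exists z; rewrite eT -eR.
have arith A R F B G : 300 * A + 300 * F + 220 * R + 240 * B <= 1000 * G -> R < 3 * B ->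
  3 * (A + R + F) <= 10 * G by clear; lia.
exact: arith hz h.
Qed.

End Core.

(** * The two sides, and the translation of gains into cuts *)

Lemma card_sum (T : finType) (P : pred T) : #|[set x | P x]| = \sum_x P x.
Proof. by rewrite -sum1_card big_mkcond; apply: eq_bigr => x _; rewrite inE; case: (P x). Qed.

Section Sides.
Variables (T : finType) (e : rel T).
Hypothesis e_irr : irreflexive e.

Definition cutp (X : {set T}) (p : T * T) := [&& e p.1 p.2, p.1 \in X & p.2 \notin X].

(* Reversing the edges inside the complement of [S] makes every vertex of either side have few
   in-neighbours among arcs and backward edges. *)
Section Sided.
Variable S : {set T}.
Let s : pred T := fun x => x \in S.
Definition side_arc : rel T := fun x y => (s x == s y) && (if s x then e x y else e y x).
Definition back_edge : rel T := fun x y => [&& s x, ~~ s y & e y x].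
Definition fore_edge : rel T := fun x y => [&& s x, ~~ s y & e x y].

Definition side_cut (z : pred T) := [set x | z x == s x].

Lemma gain_cut (W : {set T}) z :
  \sum_(p | touch W p) gain side_arc back_edge fore_edge z p = \sum_(p | touch W p) cutp (side_cut z) p.
Proof.
(* An edge leaving the complement of [S] is counted at the reversed pair, so the two sums agree only
   after adding both orders. *)
have eg x y : gain side_arc back_edge fore_edge z (x, y) =
    s x * cutp (side_cut z) (x, y) + ~~ s y * cutp (side_cut z) (y, x).
  rewrite /gain /again /rgain /fgain /cutp /side_arc /back_edge /fore_edge /side_cut /= !inE /s.
  by case: (x \in S); case: (y \in S); case: (e x y); case: (e y x); case: (z x); case: (z y).
rewrite !touch_sum; under eq_bigr do (under eq_bigr do rewrite eg); congr (_ + _).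
  under eq_bigr do rewrite big_split /=.
  rewrite big_split /= [X in _ + X]exchange_big -big_split; apply: eq_bigr => x _ /=.
  by rewrite -big_split; apply: eq_bigr => y _ /=; case: (s x); rewrite /= ?mul0n ?mul1n ?addn0.
apply: eq_bigr => x _; apply: eq_bigr => y _; rewrite !eg.
by case: (s x); case: (s y) => /=; lia.
Qed.

Lemma count_edges (W : {set T}) :
  \sum_(p | touch W p) (side_arc p.1 p.2 + back_edge p.1 p.2 + fore_edge p.1 p.2) =
  \sum_(p | touch W p) e p.1 p.2.
Proof.
have eg x y : side_arc x y + back_edge x y + fore_edge x y = s x * e x y + ~~ s y * e y x.
  rewrite /side_arc /back_edge /fore_edge /s.
  by case: (x \in S); case: (y \in S); case: (e x y); case: (e y x).
rewrite !touch_sum /=; under eq_bigr do (under eq_bigr do rewrite eg); congr (_ + _).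
  under eq_bigr do rewrite big_split /=.
  rewrite big_split /= [X in _ + X]exchange_big -big_split; apply: eq_bigr => x _ /=.
  by rewrite -big_split; apply: eq_bigr => y _ /=; case: (s x); rewrite /= ?mul0n ?mul1n ?addn0.
apply: eq_bigr => x _; apply: eq_bigr => y _; rewrite !eg.
by case: (s x); case: (s y) => /=; lia.
Qed.

End Sided.

Definition indegree v := #|[set u | e u v]|.
Definition outdegree v := #|[set u | e v u]|.
Definition sided (S : {set T}) :=
  [forall v, if v \in S then indegree v <= 2 else outdegree v <= 2].
Definition backs (S : {set T}) := \sum_(p : T * T) [&& p.1 \notin S, p.2 \in S & e p.1 p.2].

Lemma sided_deg S v : sided S -> inarcs (side_arc S) v + #|nbr (back_edge S) v| <= 2.
Proof.
move=> /forallP/(_ v) hv.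
suff h : inarcs (side_arc S) v + #|nbr (back_edge S) v| <= if v \in S then indegree v else outdegree v.
  by apply: leq_trans h _; move: hv; case: ifP.
rewrite /inarcs /nbr /indegree /outdegree !card_sum -big_split /=.
case vS: (v \in S); apply: leq_sum => x _; rewrite /sym /side_arc /back_edge vS;
  by case: (x \in S); case: (e x v); case: (e v x).
Qed.

(** Moving [v] to the other side turns its backward edges into edges inside a side and its out-arcs
    into backward edges. *)
Lemma backs_toggle (S S' : {set T}) v : (forall x, x != v -> (x \in S') = (x \in S)) -> (v \in S') = (v \notin S) ->
  backs S' + #|nbr (back_edge S) v| = backs S + #|[set w | side_arc S v w]|.
Proof.
move=> hx hv; rewrite /backs (bigID (touch [set v])) /= [X in _ = X + _](bigID (touch [set v])) /=.
rewrite [X in _ + X + _ = _](eq_bigr (fun p : T * T => [&& p.1 \notin S, p.2 \in S & e p.1 p.2] : nat)); last first.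
  by move=> p; rewrite /touch !inE negb_or => /andP[n1 n2]; rewrite !hx.
rewrite addnAC [RHS]addnAC; congr (_ + _); rewrite !touch_sum /= !big_set1 e_irr !andbF !add0n.
rewrite /nbr !card_sum [\sum_(i in ~: _) _]big_mkcond [in RHS]big_mkcond -!big_split; apply: eq_bigr => y _ /=.
rewrite !inE /sym /side_arc /back_edge; have [->|ny] := eqVneq y v.
  by rewrite e_irr !andbF eqxx if_same.
rewrite hv !hx //; by case: (v \in S); case: (y \in S); case: (e v y); case: (e y v).
Qed.

(** The assumed sum is the outdegree of [v] if [v] is in [S] and its indegree otherwise, so [v] may
    change sides without reducing the number of backward edges. *)
Lemma sided_min (S : {set T}) v : sided S -> (forall S', sided S' -> backs S <= backs S') ->
  #|[set w | side_arc S v w]| + #|nbr (fore_edge S) v| <= 2 ->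
  #|nbr (back_edge S) v| <= #|[set w | side_arc S v w]|.
Proof.
move=> hS hmin hd; pose S' := if v \in S then S :\ v else v |: S.
have hx x : x != v -> (x \in S') = (x \in S).
  by move=> nx; rewrite /S'; case: ifP; rewrite !inE ?nx // (negPf nx).
have hv : (v \in S') = (v \notin S) by rewrite /S'; case: ifP => h; rewrite !inE eqxx.
have h' : sided S'.
  apply/forallP => x; have [->|nx] := eqVneq x v; last by rewrite hx //; move/forallP: hS.
  rewrite hv; suff h : (if v \notin S then indegree v else outdegree v) <= 2 by move: h; case: ifP.
  apply: leq_trans hd; rewrite /indegree /outdegree /nbr.
  case vS: (v \in S) => /=; rewrite !card_sum -big_split /=; apply: leq_sum => y _;
    rewrite /sym /side_arc /fore_edge vS; by case: (y \in S); case: (e y v); case: (e v y).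
have := backs_toggle hx hv; have := hmin _ h'; clear; lia.
Qed.

Lemma sided_exists : (forall v, indegree v <= 2 \/ outdegree v <= 2) ->
  exists2 S, sided S & forall S', sided S' -> backs S <= backs S'.
Proof.
move=> hd; have h0 : sided [set v | indegree v <= 2].
  by apply/forallP => v; rewrite inE; case: ifP => // h; case: (hd v); rewrite // h.
by case: (arg_minnP backs h0) => S hS hmin; exists S.
Qed.

End Sides.

(** Induction on the number of edges: in the reducible case the edges touching [W] are deleted, and
    value 0 on [W] extends the cut of the rest. *)
Lemma dicut_exists (T : finType) (e : rel T) : irreflexive e ->
  (forall v, indegree e v <= 2 \/ outdegree e v <= 2) ->
  exists X : {set T}, 3 * (\sum_(p : T * T) e p.1 p.2) <= 10 * \sum_p cutp e X p.
Proof.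
have [n] := ubnP (\sum_(p : T * T) e p.1 p.2); elim: n e => // n IH e hn e_irr hd.
have [S hS hmin] := sided_exists hd.
pose a := side_arc e S; pose r := back_edge e S; pose f := fore_edge e S.
have all (g : T * T -> nat) : \sum_p g p = \sum_(p | touch [set: T] p) g p.
  by apply: eq_bigl => p; rewrite /touch inE.
have a_irr : irreflexive a by move=> x; rewrite /a /side_arc e_irr if_same andbF.
have a_same x y : a x y -> (x \in S) = (y \in S) by case/andP => /eqP.
have r_cross x y : r x y -> (x \in S) != (y \in S) by case/and3P => -> /negPf ->.
have f_cross x y : f x y -> (x \in S) != (y \in S) by case/and3P => -> /negPf ->.
have r_anti x y : r x y -> ~~ r y x by case/and3P => _ h _; rewrite /r /back_edge (negPf h).
have f_anti x y : f x y -> ~~ f y x by case/and3P => _ h _; rewrite /f /fore_edge (negPf h).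
have [[W [hW hred]]|[z hz]] := mixed_cut a_irr a_same r_cross f_cross r_anti f_anti
    (fun v => sided_deg v hS) (fun v => sided_min e_irr hS hmin).
  pose e' : rel T := fun x y => [&& e x y, x \notin W & y \notin W].
  have he p : ~~ touch W p -> e' p.1 p.2 = e p.1 p.2.
    by rewrite negb_or /e' => /andP[-> ->]; rewrite !andbT.
  have he0 p : touch W p -> e' p.1 p.2 = false.
    by rewrite /e' -negb_or => h; rewrite -/(touch W p) h andbF.
  rewrite (count_edges e S) in hW hred.
  have eE : \sum_(p : T * T) e p.1 p.2 = \sum_(p | touch W p) e p.1 p.2 + \sum_(p : T * T) e' p.1 p.2.
    rewrite (bigID (touch W)) /= [X in _ = _ + X](bigID (touch W)) /=; congr (_ + _).
    rewrite [in RHS]big1 ?add0n => [|p hp]; last by rewrite he0.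
    by apply: eq_bigr => p hp; rewrite he.
  have [|x|v|X hX] := IH e'.
  - by move: hn hW; rewrite eE; clear; lia.
  - by rewrite /e' e_irr.
  - have hi : indegree e' v <= indegree e v.
      by apply: subset_leq_card; apply/subsetP => u; rewrite !inE => /and3P[].
    have ho : outdegree e' v <= outdegree e v.
      by apply: subset_leq_card; apply/subsetP => u; rewrite !inE => /and3P[].
    by case: (hd v) => h; [left; apply: leq_trans hi h|right; apply: leq_trans ho h].
  (* Chosen so that [side_cut] gives back [X] outside [W]. *)
  pose z : pred T := fun x => (x \in X) == (x \in S).
  exists (side_cut S (comb W (fun=> false) z)).
  have := hred z; rewrite gain_cut => h1.
  rewrite eE [in X in _ <= X](bigID (touch W)) /= !mulnDr leq_add //; apply: leq_trans hX _.
  rewrite leq_mul2l /= (bigID (touch W)) /= big1 ?add0n => [|p hp]; last by rewrite /cutp he0.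
  apply: leq_sum => p hp; rewrite /cutp he //; move: hp; rewrite negb_or => /andP[n1 n2].
  rewrite /side_cut !inE /comb (negPf n1) (negPf n2) /z.
  by case: (p.1 \in X); case: (p.2 \in X); case: (p.1 \in S); case: (p.2 \in S).
exists (side_cut S z); move: hz; rewrite all [X in _ <= 10 * X]all count_edges gain_cut.
by rewrite -!all.
Qed.

(** * Directed cuts of digraphs and the rational bound *)

Import Order.TTheory GRing.Theory Num.Theory.
Local Open Scope ring_scope.

Theorem theorem14 (D : digraph) (m : nat) (hD : in_Dkl 2 2 D)
    (hm : #|edges D| = m) :
  exists C : {set D * D},
    directed_cut C /\ (3 * m%:R / 10 <= #|C|%:R :> rat).
Proof.
have [X hX] := @dicut_exists D (@edge D) (@edge_irrefl D) hD.
exists [set e in edges D | (e.1 \in X) && (e.2 \in ~: X)]; split.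
  by exists X, (~: X); split=> //; [exact: setUCr|rewrite disjoints_subset setCK].
rewrite ler_pdivrMr // -!natrM ler_nat mulnC -hm.
have eE : #|edges D| = (\sum_(p : D * D) edge p.1 p.2)%N.
  by rewrite -sum1_card big_mkcond; apply: eq_bigr => p _; rewrite inE; case: (edge _ _).
rewrite eE mulnC [X in (_ <= X)%N]mulnC; apply: leq_trans hX _; rewrite leq_mul2l /= -sum1_card.
rewrite [X in (_ <= X)%N]big_mkcond; apply: leq_sum => p _; rewrite /cutp !inE.
by case: (edge _ _); case: (p.1 \in X); case: (p.2 \in X).
Qed.
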